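(* The logic $\mathrm{S2S}+\forall^{=1}_\pi$ is strictly more expressive than $\mathrm{S2S}$: every set definable by an $\mathrm{S2S}$ formula is definable by an $\mathrm{S2S}+\forall^{=1}_\pi$ formula, and there is a set definable by an $\mathrm{S2S}+\forall^{=1}_\pi$ formula that is not definable by any $\mathrm{S2S}$ formula.
   Context: $\mathrm{S2S}$ is monadic second-order logic of the full binary tree $(\{\mathtt{L},\mathtt{R}\}^\ast,\mathrm{succ}_L,\mathrm{succ}_R)$ with $\mathrm{succ}_L=\{(w,w\mathtt{L})\}$, $\mathrm{succ}_R=\{(w,w\mathtt{R})\}$: formulas are built from atoms $\mathrm{succ}_L(x,y)$, $\mathrm{succ}_R(x,y)$, $x\in X$ using $\neg,\vee$, first-order quantification over vertices and second-order quantification over sets of vertices; a formula with free second-order variables defines the set of tuples of sets of vertices satisfying it. A path is a set of vertices containing the root, closed under prefixes, in which every element has exactly one child in the set; the set $\mathcal{P}$ of paths is identified with $\{\mathtt{L},\mathtt{R}\}^\omega$, carrying the uniform product probability measure $\mu_w$. $\mathrm{S2S}+\forall^{=1}_\pi$ adds the quantifier $\forall^{=1}_\pi X.\,\phi$: a tuple $t$ satisfies $\forall^{=1}_\pi X.\,\phi(X,\vec{Y})$ iff $\mu_w(\{p\in\mathcal{P}\mid (p,t)\text{ satisfies }\phi\})=1$. *)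

(* Defs.v *)
From HB Require Import structures.
From mathcomp Require Import all_boot all_order all_algebra finmap.
From mathcomp Require Import all_classical all_reals.
From mathcomp Require Import ereal topology normedtype sequences measure cantor.

Set Implicit Arguments.
Unset Strict Implicit.
Unset Printing Implicit Defensive.

Import Order.TTheory GRing.Theory Num.Theory.
Local Open Scope classical_set_scope.
Local Open Scope ring_scope.

(* Vertices are words over {L, R}, with L encoded by false and R by true. *)
Definition vertex := seq bool.

Definition is_path (P : set vertex) : Prop :=
  [/\ P [::],
      forall w b, P (rcons w b) -> P w &
      forall w, P w -> exists! b, P (rcons w b)].

(* An infinite word over {L, R}. *)
Definition branch := nat -> bool.
HB.instance Definition _ := Pointed.on branch.

Definition path_of (x : branch) : set vertex := range (mkseq x).

Lemma mkseqSr (T : Type) (x : nat -> T) n : mkseq x n.+1 = rcons (mkseq x n) (x n).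
Proof. by rewrite /mkseq -addn1 iotaD map_cat cats1. Qed.

Lemma path_of_inj : injective path_of.
Proof.
move=> x y xy; apply/funext => n.
have : path_of y (mkseq x n.+1) by rewrite -xy; exists n.+1.
move=> [m _ mE]; have := congr1 size mE; rewrite !size_mkseq => mn.
by have := congr1 (nth false ^~ n) mE; rewrite mn !nth_mkseq.
Qed.

Lemma path_of_bij : set_bij [set: branch] is_path path_of.
Proof.
split=> [x _|x y _ _|P [P0 Pp Pc]]; last 1 first.
- have /choice[c Hc] : forall w, exists b, P w ->
      P (rcons w b) /\ forall b', P (rcons w b') -> b = b'.
    move=> w; have [/Pc[b Hb]|nPw] := pselect (P w); first by exists b.
    by exists false.
  pose f := fix f n : seq bool :=
    if n is m.+1 then rcons (f m) (c (f m)) else [::].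
  pose x : branch := fun n => c (f n).
  have fE n : mkseq x n = f n by elim: n => [//|n IH]; rewrite mkseqSr IH.
  have Pf n : P (f n) by elim: n => [//|n IH] /=; have [] := Hc _ IH.
  exists x => //; apply/seteqP; split=> [_ [n _ <-]|w Pw]; first by rewrite fE.
  exists (size w) => //; rewrite fE.
  elim/last_ind: w Pw => [//|w b IH] Pwb; rewrite size_rcons /=.
  have Pw := Pp _ _ Pwb; have [_ /(_ _ Pwb) cb] := Hc _ Pw.
  by rewrite (IH Pw) cb.
- split; first by exists 0%N.
    move=> w b [[|n] _ nE]; first by case: w nE.
    by move: nE; rewrite mkseqSr => /rcons_inj[<- _]; exists n.
  move=> _ [n _ <-]; exists (x n); split; first by exists n.+1; rewrite // mkseqSr.
  move=> b [m _ mE]; have := congr1 size mE.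
  rewrite size_rcons !size_mkseq => mn.
  by move: mE; rewrite mn mkseqSr => /rcons_inj[].
- exact: path_of_inj.
Qed.

(* The uniform product measure on infinite words: uniform counting on the
   algebra of the sets that depend on finitely many coordinates, extended by
   the Caratheodory theorem. *)
Definition determined n (A : set branch) : Prop :=
  forall x y : branch, (forall i, (i < n)%N -> x i = y i) -> A x -> A y.

Definition cylinder_sets : set (set branch) :=
  [set A | exists n, determined n A].

Lemma determinedW m n A : (m <= n)%N -> determined m A -> determined n A.
Proof. by move=> mn dA x y xy; apply: dA => i im; apply/xy/(leq_trans im). Qed.

Lemma cylinder_sets0 : cylinder_sets set0.
Proof. by exists 0%N. Qed.

Lemma cylinder_setsU : setU_closed cylinder_sets.
Proof.
move=> A B [m dA] [n dB]; exists (maxn m n) => x y xy [Ax|Bx].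
  by left; apply: (determinedW (leq_maxl m n) dA xy).
by right; apply: (determinedW (leq_maxr m n) dB xy).
Qed.

Lemma cylinder_setsC : setC_closed cylinder_sets.
Proof.
move=> A [n dA]; exists n => x y xy nAx Ay; apply: nAx.
by apply: dA Ay => i /xy.
Qed.

HB.instance Definition _ := isAlgebraOfSets.Build default_measure_display branch
  cylinder_sets0 cylinder_setsU cylinder_setsC.

Definition words n (A : set branch) : {set n.-tuple bool} :=
  [set t : n.-tuple bool | `[< exists2 x, A x & mkseq x n = tval t >]]%SET.

Definition level (A : set branch) : nat := xget 0%N [set n | determined n A].

Definition cylinder_mass (R : realType) (A : set branch) : \bar R :=
  (#|words (level A) A|%:R / 2 ^+ level A)%:E.

Lemma wordsS n A : determined n A -> #|words n.+1 A| = (#|words n A| * 2)%N.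
Proof.
move=> dA; rewrite -card_bool -cardsT -cardsX.
pose g (p : n.-tuple bool * bool) : n.+1.-tuple bool := [tuple of rcons p.1 p.2].
have g_inj : injective g.
  move=> [t b] [t' b'] /(congr1 (fun u : n.+1.-tuple bool => tval u)) /=.
  by move=> /rcons_inj[/val_inj -> ->].
rewrite -(card_imset _ g_inj); congr #|pred_of_set _|; apply/setP => t.
apply/idP/imsetP.
  rewrite inE => /asboolP[x Ax xt].
  exists ([tuple of mkseq x n], x n).
    by rewrite !inE andbT; apply/asboolP; exists x.
  by apply: val_inj => /=; rewrite -mkseqSr.
move=> [[u b]]; rewrite !inE andbT /= => /asboolP[x Ax xu] ->.
pose y : branch := fun i => if i == n then b else x i.
have xy i : (i < n)%N -> x i = y i by rewrite /y ltn_neqAle => /andP[/negPf ->].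
exists y; first exact: dA xy Ax.
rewrite /= mkseqSr {2}/y eqxx -xu; congr rcons.
by apply/eq_in_map => i; rewrite mem_iota => /andP[_ /xy].
Qed.

Section cylinder_mass.
Variable R : realType.
Implicit Types A B : set branch.

Lemma words_le m n A : (m <= n)%N -> determined m A ->
  #|words n A|%:R / 2 ^+ n = #|words m A|%:R / 2 ^+ m :> R.
Proof.
move=> mn dA; elim: n mn => [|n IH]; first by rewrite leqn0 => /eqP ->.
rewrite leq_eqVlt => /predU1P[->//|mn]; rewrite -IH// wordsS; last first.
  exact: determinedW dA.
by rewrite natrM exprS invfM mulrA mulfK ?pnatr_eq0.
Qed.

Lemma cylinder_massE n A : determined n A ->
  cylinder_mass R A = (#|words n A|%:R / 2 ^+ n)%:E.
Proof.
move=> dA; rewrite /cylinder_mass; congr EFin.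
have dl : determined (level A) A by apply: (@xgetPex _ 0%N [set n | determined n A]); exists n.
rewrite -(words_le (leq_maxl _ n) dl); exact: words_le (leq_maxr _ _) dA.
Qed.

Lemma cylinder_mass0 : cylinder_mass R set0 = 0%E.
Proof.
rewrite (@cylinder_massE 0%N)// (_ : words 0 set0 = finset.set0) ?cards0 ?mul0r//.
by apply/setP => t; rewrite !inE; apply/asboolP => -[].
Qed.

Lemma cylinder_mass_ge0 A : (0 <= cylinder_mass R A)%E.
Proof. by rewrite lee_fin divr_ge0// exprn_ge0. Qed.

Lemma cylinder_massU A B : measurable A -> measurable B -> [disjoint A & B] ->
  cylinder_mass R (A `|` B) = (cylinder_mass R A + cylinder_mass R B)%E.
Proof.
move=> [m dA] [n dB] /disj_set2P AB0; pose k := maxn m n.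
have {}dA : determined k A by apply: determinedW dA; exact: leq_maxl.
have {}dB : determined k B by apply: determinedW dB; exact: leq_maxr.
have dAB : determined k (A `|` B).
  by move=> x y xy [Ax|Bx]; [left; exact: dA Ax|right; exact: dB Bx].
rewrite !(@cylinder_massE k)// -EFinD -mulrDl -natrD -cardsUI.
rewrite (_ : words k A :&: words k B = finset.set0); last first.
  apply/setP => t; rewrite !inE; apply/negP => /andP[/asboolP[x Ax xt]].
  move=> /asboolP[y By yt]; suff : (A `&` B) y by rewrite AB0.
  split=> //; apply: dA Ax => i ik.
  by rewrite -(nth_mkseq false x ik) xt -yt nth_mkseq.
rewrite cards0 addn0 (_ : words k A :|: words k B = words k (A `|` B))//.
apply/setP => t; rewrite !inE; apply/orP/asboolP.
  by move=> [|] /asboolP[x Hx xt]; exists x => //; [left|right].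
by move=> [x [Ax|Bx] xt]; [left|right]; apply/asboolP; exists x.
Qed.

Lemma cylinder_mass_bigU (F : (set branch)^nat) n :
  (forall i, measurable (F i)) -> trivIset setT F ->
  cylinder_mass R (\big[setU/set0]_(i < n) F i)
    = (\sum_(i < n) cylinder_mass R (F i))%E.
Proof.
move=> mF tF; elim: n => [|n IH]; first by rewrite !big_ord0 cylinder_mass0.
rewrite !big_ord_recr /= cylinder_massU ?IH//; first exact: bigsetU_measurable.
apply/disj_set2P; rewrite -subset0 => x [].
rewrite -bigcup_mkord => -[i /= ilt Fi Fn].
by have := tF i n I I (ex_intro _ x (conj Fi Fn)) => iE; rewrite iE ltnn in ilt.
Qed.

Lemma cylinder_open A : measurable A -> open (A : set cantor_space).
Proof.
move=> [n dA]; rewrite openE => x Ax.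
pose N (i : 'I_n) : set cantor_space := [set y | x i = y i].
have : nbhs x [set y | forall i, N i y].
  apply: (@filter_forall cantor_space _ N (nbhs x)) => i.
  have := @proj_continuous nat (fun=> bool) i x [set x i].
  rewrite /nbhs/= => /(_ (discrete_set1 (x i))).
  by apply: filterS => y /esym.
by apply: filterS => y Ny; apply: (dA x) => // i ilt; exact: (Ny (Ordinal ilt)).
Qed.

Lemma cylinder_mass_sigma_additive : semi_sigma_additive (cylinder_mass R).
Proof.
move=> F mF tF mU.
have : compact (\bigcup_n F n : set cantor_space).
  apply: (subclosed_compact _ cantor_space_compact) => //.
  rewrite -[X in closed X]setCK; apply: open_closedC; apply: cylinder_open.
  exact: measurableC.
rewrite compact_cover => /(_ nat setT F) []//; first by move=> i _; exact: cylinder_open.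
move=> D _ DF.
pose N := (\max_(i <- D) i).+1.
have Fe n : (N <= n)%N -> F n = set0.
  move=> Nn; rewrite -subset0 => x Fnx.
  have [i /= iD Fix] := DF x (ex_intro2 _ _ n I Fnx).
  have iE : i = n by apply: (tF i n I I); exists x.
  by move: Nn; rewrite -iE /N ltnNge (@leq_bigmax_seq _ _ xpredT id i).
apply: cvg_near_cst; exists N => // n /= Nn.
rewrite big_mkord -cylinder_mass_bigU//; congr (cylinder_mass R _).
rewrite -bigcup_mkord; apply/seteqP; split=> x [i _ Fix]; first by exists i.
exists i => //=; rewrite ltnNge; apply/negP => ni.
by rewrite Fe in Fix; rewrite ?(leq_trans Nn).
Qed.

HB.instance Definition _ := isMeasure.Build _ _ _ (cylinder_mass R)
  cylinder_mass0 cylinder_mass_ge0 cylinder_mass_sigma_additive.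

End cylinder_mass.

Section path_measure.
Variable R : realType.
Local Open Scope measure_scope.

Definition branchType : measurableType _ :=
  caratheodory_type ((cylinder_mass R)^*).

Definition mu_w : set branchType -> \bar R :=
  @completed_measure_extension _ branch R (cylinder_mass R).

HB.instance Definition _ := Measure.on mu_w.

Definition cylinder (w : vertex) : set branchType :=
  [set x : branch | mkseq x (size w) = w].

Lemma determined_cylinder w : determined (size w) (cylinder w).
Proof.
move=> x y xy xw; rewrite /cylinder /= -[RHS]xw.
by apply/eq_in_map => i; rewrite mem_iota => /andP[_ /xy].
Qed.

Lemma cylinder_measurable w : measurable (cylinder w).
Proof.
apply: (@caratheodory_measurable_mu_ext _ R branch (cylinder_mass R)).
by exists (size w); exact: determined_cylinder.
Qed.

Lemma mu_w_cylinder w : mu_w (cylinder w) = (2 ^- size w)%:E.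
Proof.
have dw := @determined_cylinder w.
transitivity (cylinder_mass R (cylinder w)).
  by apply: (@measurable_mu_extE _ R branch (cylinder_mass R)); exists (size w).
rewrite (cylinder_massE _ dw) (_ : words _ _ = [set in_tuple w]%SET).
  by rewrite cards1 mul1r.
apply/setP => t; rewrite !inE; apply/asboolP/eqP => [[x xw xt]|->].
  by apply: val_inj; rewrite /= -xt.
exists (nth false w); last exact: mkseq_nth.
exact: mkseq_nth.
Qed.

(* Sets of paths are measured through the identification path_of. A set has
   probability 1 when it is measurable for the completion of the product
   measure, and has measure 1. *)
Definition path_prob1 (S : set (set vertex)) : Prop :=
  let A : set branchType := path_of @^-1` S in measurable A /\ mu_w A = 1%E.

End path_measure.

(* ForallPath1 is the almost-all-paths quantifier of S2S + forall^{=1}_pi; the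
   formulas without it are those of S2S. *)

Inductive formula : Type :=
| SuccL (x y : nat)
| SuccR (x y : nat)
| Mem (x X : nat)
| Not (phi : formula)
| Or (phi psi : formula)
| Exists1 (x : nat) (phi : formula)
| Forall1 (x : nat) (phi : formula)
| Exists2 (X : nat) (phi : formula)
| Forall2 (X : nat) (phi : formula)
| ForallPath1 (X : nat) (phi : formula).

Fixpoint is_S2S (phi : formula) : bool :=
  match phi with
  | SuccL _ _ | SuccR _ _ | Mem _ _ => true
  | Not phi => is_S2S phi
  | Or phi psi => is_S2S phi && is_S2S psi
  | Exists1 _ phi | Forall1 _ phi | Exists2 _ phi | Forall2 _ phi => is_S2S phi
  | ForallPath1 _ _ => false
  end.

Fixpoint free1 (phi : formula) : seq nat :=
  match phi with
  | SuccL x y | SuccR x y => [:: x; y]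
  | Mem x _ => [:: x]
  | Not phi => free1 phi
  | Or phi psi => free1 phi ++ free1 psi
  | Exists1 x phi | Forall1 x phi => [seq y <- free1 phi | y != x]
  | Exists2 _ phi | Forall2 _ phi | ForallPath1 _ phi => free1 phi
  end.

Fixpoint free2 (phi : formula) : seq nat :=
  match phi with
  | SuccL _ _ | SuccR _ _ => [::]
  | Mem _ X => [:: X]
  | Not phi => free2 phi
  | Or phi psi => free2 phi ++ free2 psi
  | Exists1 _ phi | Forall1 _ phi => free2 phi
  | Exists2 X phi | Forall2 X phi | ForallPath1 X phi =>
      [seq Y <- free2 phi | Y != X]
  end.

Definition update (T : Type) (e : nat -> T) (i : nat) (v : T) : nat -> T :=
  fun j => if j == i then v else e j.

Fixpoint sat (R : realType) (phi : formula)
    (e1 : nat -> vertex) (e2 : nat -> set vertex) : Prop :=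
  match phi with
  | SuccL x y => e1 y = rcons (e1 x) false
  | SuccR x y => e1 y = rcons (e1 x) true
  | Mem x X => e2 X (e1 x)
  | Not phi => ~ sat R phi e1 e2
  | Or phi psi => sat R phi e1 e2 \/ sat R psi e1 e2
  | Exists1 x phi => exists v : vertex, sat R phi (update e1 x v) e2
  | Forall1 x phi => forall v : vertex, sat R phi (update e1 x v) e2
  | Exists2 X phi => exists V : set vertex, sat R phi e1 (update e2 X V)
  | Forall2 X phi => forall V : set vertex, sat R phi e1 (update e2 X V)
  | ForallPath1 X phi =>
      path_prob1 R [set P | is_path P /\ sat R phi e1 (update e2 X P)]
  end.

(* The i-th component of an n-tuple interprets the second-order variable i; the
   other variables get a default value, irrelevant when they are not free. *)
Definition tuple_env n (t : 'I_n -> set vertex) : nat -> set vertex :=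
  fun X => if insub X is Some i then t i else set0.

Definition defined_set (R : realType) n (phi : formula) :
    set ('I_n -> set vertex) :=
  [set t | sat R phi (fun=> [::]) (tuple_env t)].

Definition only_free2 n (phi : formula) : bool :=
  (free1 phi == [::]) && all (fun X => X < n)%N (free2 phi).

Definition S2S_pi_definable (R : realType) n (D : set ('I_n -> set vertex)) :
    Prop :=
  exists phi, only_free2 n phi /\ D = defined_set R phi.

Definition S2S_definable (R : realType) n (D : set ('I_n -> set vertex)) :
    Prop :=
  exists phi, [/\ is_S2S phi, only_free2 n phi & D = defined_set R phi].

(* Main.v *)
Require Import Defs.
From mathcomp Require Import all_boot all_order all_algebra.
From mathcomp Require Import all_classical all_reals.
From mathcomp Require Import ereal topology normedtype sequences measure.
From mathcomp Require Import wochoice zify.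

Set Implicit Arguments.
Unset Strict Implicit.
Unset Printing Implicit Defensive.

(** The separating set consists of the sets X of vertices that meet every
    subtree and that a random path avoids with positive probability. It is not
    empty: below the i-th vertex, select one vertex at distance i + 2, so that
    a path meets X with probability at most 1/2. By Rabin's theorem an S2S
    formula satisfied by some X is satisfied by a regular one; but if a regular
    X meets every subtree, it does so within a bounded distance m, hence
    a random path avoids X for m * j steps with probability at most
    (1 - 2^-m)^j, and meets X almost surely.

    Rabin's theorem is proved with nondeterministic parity tree automata. For
    the complement, positional determinacy of parity games turns the rejection
    of a tree into a labelling by a positional strategy of the player Adam; this
    strategy wins if on each branch all consistent plays win, a property of
    infinite words that is checked by a deterministic parity automaton.
    Positional determinacy also gives a regular tree in each nonempty language. *)

(** * Parity conditions and positional determinacy *)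

(** Max-parity condition: [k] is the limit superior of [s]. The player [true] (Adam) wins when it is
    odd, the player [false] (Eve) when it is even. *)
Definition wins (b : bool) (s : nat -> nat) : Prop :=
  exists k, [/\ odd k = b, forall n, exists2 m, n <= m & s m = k &
                exists n, forall m, n <= m -> s m <= k].

Lemma wins_excl s : wins true s -> wins false s -> False.
Proof.
move=> [k [ok ik [n bk]]] [l [ol il [m bl]]].
have [j nj jk] := ik m; have [i mi il'] := il n.
have : k = l by apply/anti_leq; rewrite -{1}jk bl// -il' bk.
by move=> kl; rewrite kl ol in ok.
Qed.

Lemma wins_ext b s s' : s =1 s' -> wins b s -> wins b s'.
Proof. by move=> /funext ->. Qed.

(** The least eventual bound of [s] is reached infinitely often, for otherwise it could be
    decreased. *)
Lemma wins_total s B : (forall n, s n <= B) -> wins true s \/ wins false s.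
Proof.
move=> sB; pose P k := `[< exists n, forall m, n <= m -> s m <= k >].
have exP : exists k, P k by exists B; apply/asboolP; exists 0.
have [k /asboolP[n kn] mink] := ex_minnP exP.
suff : wins (odd k) s by case: (odd k); [left|right].
exists k; split => //; last by exists n.
move=> n'; apply: contrapT => nk.
have lt m : maxn n n' <= m -> s m < k.
  rewrite geq_max => /andP[nm n'm]; rewrite ltn_neqAle kn// andbT.
  by apply/eqP => smk; apply: nk; exists m.
have k0 : 0 < k by apply: leq_trans (lt _ (leqnn _)).
have /mink : P k.-1.
  by apply/asboolP; exists (maxn n n') => m /lt; case: k {mink k0 lt kn nk}.
by rewrite leqNgt ltn_predL k0.
Qed.

Section cuts.
Variable k : nat -> nat.
Hypothesis kS : forall i, k i < k i.+1.

Lemma cuts_le i j : i <= j -> k i <= k j.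
Proof.
move=> /subnK <-; elim: (j - i) => // n IH; rewrite addSn.
exact: leq_trans IH (ltnW (kS _)).
Qed.

Lemma cuts_ge i : i <= k i.
Proof. by elim: i => // i IH; apply: leq_ltn_trans (kS i). Qed.

Lemma cuts_cover m : k 0 <= m -> exists i, k i <= m < k i.+1.
Proof.
move=> k0m; have exP : exists i, k i <= m by exists 0.
have [i im maxi] := ex_maxnP exP (fun i => leq_trans (cuts_ge i)).
by exists i; rewrite im ltnNge; apply/negP => /maxi; rewrite ltnn.
Qed.

Lemma cuts_uniq i j m : k i <= m < k i.+1 -> k j <= m < k j.+1 -> i = j.
Proof.
move=> /andP[im mi] /andP[jm mj]; apply/anti_leq/andP; split.
  by rewrite leqNgt; apply/negP => /cuts_le; rewrite leqNgt (leq_ltn_trans im).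
by rewrite leqNgt; apply/negP => /cuts_le; rewrite leqNgt (leq_ltn_trans jm).
Qed.

(** Here [v i] is the maximum of [u] on the [i]-th block, and passing to block maxima preserves the
    limit superior. *)
Lemma wins_blocks b u v :
  (forall i m, k i <= m < k i.+1 -> u m <= v i) ->
  (forall i, exists2 m, k i <= m < k i.+1 & u m = v i) ->
  wins b u <-> wins b v.
Proof.
move=> uv vu; split=> -[c [oc ic [n bc]]]; exists c; split => //.
- move=> i0; have [m mi umc] := ic (k (maxn i0 n)).
  have [|i /andP[kim mki]] := @cuts_cover m.
    by apply: leq_trans mi; exact: cuts_le.
  have : maxn i0 n <= i.
    rewrite leqNgt; apply/negP => ii; have := leq_ltn_trans mi mki.
    by rewrite ltnNge cuts_le.
  rewrite geq_max => /andP[i0i ni].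
  exists i => //; apply/anti_leq; rewrite -{2}umc uv ?kim // andbT.
  have [m' /andP[kim' _] <-] := vu i.
  by apply: bc; apply: leq_trans ni _; apply: leq_trans (cuts_ge i) kim'.
- exists n => i ni; have [m /andP[kim _] <-] := vu i.
  by apply: bc; apply: leq_trans ni _; apply: leq_trans (cuts_ge i) kim.
- move=> n0; have [i n0i vic] := ic n0; have [m /andP[kim _] um] := vu i.
  exists m; last by rewrite um.
  by apply: leq_trans n0i _; apply: leq_trans (cuts_ge i) kim.
- exists (k n) => m knm; have [|i kim] := @cuts_cover m.
    by apply: leq_trans knm; exact: cuts_le.
  apply: leq_trans (uv _ _ kim) (bc _ _).
  rewrite leqNgt; apply/negP => ii; case/andP: kim => _.
  by rewrite ltnNge (leq_trans _ knm)// cuts_le.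
Qed.

(** At a cut the run of the next block is read, which is why consecutive runs have to agree
    there. *)
Lemma glue_blocks (Q : Type) (R : nat -> nat -> Q) :
  (forall i, R i (k i.+1) = R i.+1 (k i.+1)) ->
  exists r, forall i m, k i <= m <= k i.+1 -> r m = R i m.
Proof.
move=> RS.
have /choice[seg segP] : forall m, exists i, forall j, k j <= m < k j.+1 -> i = j.
  move=> m; have [[i im]|nm] := pselect (exists i, k i <= m < k i.+1).
    by exists i => j; exact: cuts_uniq im.
  by exists 0 => j jm; case: nm; exists j.
exists (fun m => R (seg m) m) => i m; rewrite leq_eqVlt (leq_eqVlt m).
have [->|] := eqVneq m (k i.+1).
  by rewrite (segP _ i.+1) ?RS // leqnn kS.
move=> /= _; rewrite -leq_eqVlt => im; by rewrite (segP _ i).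
Qed.

End cuts.

Lemma wins_shift b k s : wins b (fun n => s (k + n)) <-> wins b s.
Proof.
apply: iff_sym; apply: (@wins_blocks (addn k)) => i.
- by rewrite addnS.
- by move=> m; rewrite addnS ltnS -eqn_leq => /eqP <-.
- by exists (k + i) => //; rewrite addnS leqnn /=.
Qed.

Lemma neq_negb (x b : bool) : x != b -> x = ~~ b.
Proof. by case: x b => -[]. Qed.

Lemma no_negb (b : bool) : b <> ~~ b.
Proof. by case: b. Qed.

Section game.
Variables (V : Type) (own : V -> bool) (E : V -> V -> Prop) (pr : V -> nat).

Implicit Types (U T W : V -> Prop) (O : (nat -> V) -> Prop) (b : bool).

Definition play U b (sg : V -> V) (s : nat -> V) : Prop :=
  forall i, [/\ E (s i) (s i.+1), U (s i.+1) &
                own (s i) = b -> s i.+1 = sg (s i)].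

(* From W, the positional strategy sg lets player b either reach T or meet the
   objective O in the subgame U, where the opponent may also get stuck. *)
Definition strategy_on U T b O W (sg : V -> V) : Prop :=
  [/\ forall v, W v -> U v,
      forall v, W v -> ~ T v -> own v = b -> E v (sg v) /\ W (sg v),
      forall v v', W v -> ~ T v -> own v = ~~ b -> U v' -> E v v' -> W v' &
      forall s, W (s 0) -> play U b sg s -> (forall i, ~ T (s i)) -> O s].

Definition region U T b O (v : V) : Prop :=
  exists W sg, strategy_on U T b O W sg /\ W v.

Lemma play_shift U b sg s k : play U b sg s ->
  play U b sg (fun n => s (k + n)).
Proof. by move=> ps i; rewrite addnS; exact: ps. Qed.

(** A decreasing sequence is constant once it has reached its minimum. [well_order] provides unique
    minima, so totality, antisymmetry and transitivity are extracted from the minima of sets of two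
    or three elements. *)
Lemma well_founded_descent (I : Type) (R : I -> I -> bool) :
  @well_order I R -> forall i : nat -> I, (forall n, R (i n.+1) (i n)) ->
  exists N, forall n, N <= n -> i n = i N.
Proof.
move=> woR i iR.
have tot : forall x y, R x y \/ R y x.
  move=> x y; have [] := woR [pred z | `[< z = x \/ z = y >]].
    by exists x; apply/asboolP; left.
  move=> z [[/asboolP zE lb] _].
  have Rx : R z x by apply: lb; apply/asboolP; left.
  have Ry : R z y by apply: lb; apply/asboolP; right.
  by case: zE => zE; [left|right]; rewrite -{1}zE.
have anti x y : R x y -> R y x -> x = y.
  move=> xy yx; have [] := woR [pred z | `[< z = x \/ z = y >]].
    by exists x; apply/asboolP; left.
  have rfl z : R z z by case: (tot z z).
  move=> z [_ uz]; rewrite -(uz x) ?(uz y) //; split.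
  - by apply/asboolP; right.
  - by move=> t /asboolP[->|->].
  - by apply/asboolP; left.
  - by move=> t /asboolP[->|->].
have [] := woR [pred z | `[< exists n, z = i n >]].
  by exists (i 0); apply/asboolP; exists 0.
move=> z [[/asboolP[N zN] lb] _]; exists N => n Nn.
apply: (anti); last by rewrite -zN; apply: lb; apply/asboolP; exists n.
have trans x y t : R x y -> R y t -> R x t.
  move=> xy yt; have [] := woR [pred z | `[< [\/ z = x, z = y | z = t] >]].
    by exists x; apply/asboolP; apply: Or31.
  move=> w [[/asboolP wE lbw] _].
  have wx : R w x by apply: lbw; apply/asboolP; apply: Or31.
  have wy : R w y by apply: lbw; apply/asboolP; apply: Or32.
  have wt : R w t by apply: lbw; apply/asboolP; apply: Or33.
  case: wE => wE; first by rewrite -wE.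
    by rewrite (anti x y xy) // -wE.
  by rewrite wE in wy; rewrite -(anti _ _ yt wy).
have rfl x : R x x by case: (tot x x).
rewrite -(subnK Nn); elim: (n - N) => [|m IH]; first exact: rfl.
by apply: trans IH; exact: iR.
Qed.

Section region.
Variables (U T : V -> Prop) (b : bool) (O : (nat -> V) -> Prop).
Hypothesis O_shift : forall s k, O (fun n => s (k + n)) -> O s.

(* The strategies are well-ordered, and each position of the union uses the
   least strategy that works there; along a play this strategy can only
   decrease, so that it is eventually constant. *)
Lemma region_strategy : exists sg, strategy_on U T b O (region U T b O) sg.
Proof.
pose I := {classic ((V -> Prop) * (V -> V))%type}.
have [R woR] := well_ordering_principle I.
pose P v : {pred I} := [pred i : I | `[< strategy_on U T b O i.1 i.2 /\ i.1 v >]].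
have exi v : exists i : I, region U T b O v -> minimum_of R (P v) i.
  have [[W [sg WP]]|nr] := pselect (region U T b O v); last first.
    by exists ((fun=> True), id).
  have [|i [Pi _]] := woR (P v); last by exists i.
  by exists (W, sg); apply/asboolP.
have [idx idxP] := choice exi.
have idxG v : region U T b O v -> strategy_on U T b O (idx v).1 (idx v).2 /\ (idx v).1 v.
  by move=> /idxP[/asboolP].
have idx_le v v' : region U T b O v -> (idx v).1 v' -> R (idx v') (idx v).
  move=> rv iv'; have [G _] := idxG _ rv.
  have /idxP[_] : region U T b O v' by exists (idx v).1, (idx v).2.
  by apply; apply/asboolP.
exists (fun v => (idx v).2 v); split.
- by move=> v /idxG[[WU _ _ _] /WU].
- move=> v /idxG[G iv] nT ob; have [_ /(_ _ iv nT ob)[? ?] _ _] := G.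
  by split => //; exists (idx v).1, (idx v).2.
- move=> v v' /idxG[G iv] nT ob Uv' Ev; have [_ _ iW _] := G.
  by exists (idx v).1, (idx v).2; split => //; exact: iW Ev.
- move=> s r0 ps nT.
  have rS n : region U T b O (s n) -> (idx (s n)).1 (s n.+1).
    move=> rn; have [[_ G1 G2 _] iv] := idxG _ rn; have [Es Us sE] := ps n.
    case: (eqVneq (own (s n)) b) => ob; first by rewrite sE //; case: (G1 _ iv).
    by apply: G2 Us Es => //; exact: neq_negb.
  have r n : region U T b O (s n).
    elim: n => // n IH; have [G _] := idxG _ IH.
    by exists (idx (s n)).1, (idx (s n)).2; split => //; exact: rS.
  have [|N NE] := well_founded_descent woR (i := fun n => idx (s n)).
    by move=> n; apply: idx_le => //; exact: rS.
  have [[_ _ _ G4] iv] := idxG _ (r N).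
  apply: (O_shift (k := N)); apply: G4 => //; first by rewrite addn0.
  move=> i; rewrite addnS; have [Es Us sE] := ps (N + i); split => //.
  by move=> /sE ->; rewrite NE ?leq_addr.
Qed.

(** The strategy on the region is changed only at [v], which lies outside of it; a play from [v]
    enters the region with its first move and stays there. *)
Lemma region_step v : U v ->
  (own v = b -> exists2 v', E v v' & region U T b O v') ->
  (own v = ~~ b -> forall v', U v' -> E v v' -> region U T b O v') ->
  region U T b O v.
Proof.
move=> Uv vb vnb; have [sg [G0 G1 G2 G3]] := region_strategy.
have [//|nr] := pselect (region U T b O v).
have [v0 v0P] : exists v0, own v = b -> E v v0 /\ region U T b O v0.
  case: (eqVneq (own v) b) => [/[dup] ob /vb[v' ? ?]|ob]; first by exists v'.
  by exists v => /eqP; rewrite (negPf ob).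
pose sg' u := if pselect (u = v) then v0 else sg u.
have sg'E u : region U T b O u -> sg' u = sg u.
  by move=> ru; rewrite /sg'; case: pselect => // e; case: nr; rewrite -e.
have sg'v : sg' v = v0 by rewrite /sg'; case: pselect.
exists (fun u => region U T b O u \/ u = v), sg'; split; last by right.
split.
- by move=> u [/G0|->].
- move=> u [ru|->] nT ob.
    by rewrite sg'E //; have [? ?] := G1 _ ru nT ob; split; [|left].
  by rewrite sg'v; have [? ?] := v0P ob; split; [|left].
- move=> u u' [ru|->] nT ob Uu' Eu; left; first exact: G2 Eu.
  exact: vnb.
- have key s : region U T b O (s 0) -> play U b sg' s -> (forall i, ~ T (s i)) -> O s.
    move=> r0 ps nT; have rs n : region U T b O (s n).
      elim: n => // n rn; have [Es Us sE] := ps n.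
      case: (eqVneq (own (s n)) b) => ob.
        by rewrite sE // sg'E //; case: (G1 _ rn).
      by apply: G2 Us Es => //; exact: neq_negb.
    apply: G3 => // i; have [? ? sE] := ps i; split => //.
    by move/sE => ->; rewrite sg'E.
  move=> s [r0|s0v] ps nT; first exact: key.
  apply: (O_shift (k := 1)); apply: key; last by move=> i; exact: nT.
    have [Es Us sE] := ps 0; case: (eqVneq (own (s 0)) b) => ob.
      by rewrite add1n sE // s0v sg'v; rewrite s0v in ob; case: (v0P ob).
    rewrite add1n; rewrite s0v in Es ob; apply: vnb => //.
    exact: neq_negb.
  exact: play_shift.
Qed.

Lemma region_target v : U v -> T v -> region U T b O v.
Proof.
move=> Uv Tv; exists (fun u => U u /\ T u), id; split => //; split => //.
- by move=> u [].
- by move=> u [_ Tu] /(_ Tu).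
- by move=> u u' [_ Tu] /(_ Tu).
- by move=> s [_ T0] _ /(_ 0).
Qed.

End region.

Definition parity_obj b (s : nat -> V) : Prop := wins b (fun n => pr (s n)).
Definition winning U b : V -> Prop := region U (fun=> False) b (parity_obj b).

Lemma parity_obj_shift b s k : parity_obj b (fun n => s (k + n)) -> parity_obj b s.
Proof. exact: (iffLR (wins_shift b k (fun n => pr (s n)))). Qed.

Lemma winning_strategy U b :
  exists sg, strategy_on U (fun=> False) b (parity_obj b) (winning U b) sg.
Proof. exact/region_strategy/parity_obj_shift. Qed.

(** Zielonka's argument, by induction on the number of priorities: the player [P] favoured by the
    top priority [n] wins wherever the opponent does not. *)
Lemma positional_determinacy n U : (forall v, U v -> pr v < n) ->
  forall v, U v -> winning U true v \/ winning U false v.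
Proof.
elim: n U => [|n IH] U Un v Uv; first by have := Un _ Uv.
pose P := odd n; pose Wo := winning U (~~ P).
suff Ub : forall u, U u -> ~ Wo u -> winning U P u.
  have [Wv|/(Ub _ Uv) Wv] := pselect (Wo v); last first.
    by move: Wv; rewrite /P; case: (odd n); [left|right].
  by move: Wv; rewrite /Wo /P; case: (odd n) => /=; [right|left].
(* [U1] is what the opponent's region [Wo] leaves. As no play satisfies [O0], [A] is the attractor
   of [P] to the positions of priority [n] in [U1]; on the rest [Z], priorities are below [n]. *)
pose U1 u := U u /\ ~ Wo u; pose N u := U u /\ pr u = n.
pose O0 (s : nat -> V) := False; pose A := region U1 N P O0.
have O0_shift s k : O0 (fun n => s (k + n)) -> O0 s by [].
pose Z u := U1 u /\ ~ A u.
have Wo_step := region_step (U := U) (T := fun=> False) (@parity_obj_shift (~~ P)).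
have Pcl u u' : U1 u -> own u = ~~ P -> U u' -> E u u' -> U1 u'.
  move=> [Uu nW] ou Uu' Eu; split=> // Wu'; apply: nW; apply: Wo_step => //.
    by move=> _; exists u'.
  by rewrite ou => /no_negb.
have Pmv u : U1 u -> own u = P -> exists2 u', E u u' & U1 u'.
  move=> [Uu nW] ou; apply: contrapT => nE; apply: nW; apply: Wo_step => //.
    by rewrite ou => /no_negb.
  move=> _ u' Uu' Eu; apply: contrapT => nW; apply: nE; exists u' => //.
have NA u : U1 u -> pr u = n -> A u.
  by move=> U1u prn; apply: region_target => //; split => //; case: U1u.
have A_step := region_step (U := U1) (T := N) (b := P) O0_shift.
have [sgW [W0 W1 W2 W3]] := winning_strategy U (~~ P).
have Zlt u : Z u -> pr u < n.
  move=> [/[dup] U1u [Uu _] nA]; rewrite ltn_neqAle -ltnS Un // andbT.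
  by apply/eqP => /(NA _ U1u).
(* If the opponent could win in [Z], playing there and switching to [sgW] on reaching [Wo] would win
   in [U] as well: [P] cannot move from [Z] to [A], since its position would then be in the
   attractor already. *)
have Zno u : ~ winning Z (~~ P) u.
  move=> wu; have [sgZ [Z0 Z1 Z2 Z3]] := winning_strategy Z (~~ P).
  have [[Uu nWu] nAu] := Z0 _ wu; apply: nWu.
  pose sg u := if pselect (Wo u) then sgW u else sgZ u.
  have sgWE x : Wo x -> sg x = sgW x by rewrite /sg; case: pselect.
  have sgZE x : ~ Wo x -> sg x = sgZ x by rewrite /sg; case: pselect.
  exists (fun x => Wo x \/ winning Z (~~ P) x), sg; split; last by right.
  have step x y : own x = P -> winning Z (~~ P) x -> U y -> E x y ->
      Wo y \/ winning Z (~~ P) y.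
    move=> ox wx Uy Ey; have [Wy|nWy] := pselect (Wo y); first by left.
    have [U1x nAx] := Z0 _ wx; right; apply: (Z2 x) => //; first by rewrite negbK.
    split => // Ay; apply: nAx; apply: A_step => //; first by exists y.
    by rewrite ox => /no_negb.
  have stepo x : own x = ~~ P -> winning Z (~~ P) x ->
      E x (sg x) /\ winning Z (~~ P) (sg x).
    move=> ox wx; have [[_ nWx] _] := Z0 _ wx; rewrite sgZE //.
    by apply: Z1.
  split.
  - by move=> x [/W0|/Z0[[]]].
  - move=> x [Wx|wx] _ ox; last by have [? ?] := stepo _ ox wx; split => //; right.
    by rewrite sgWE //; have [//|//|? ?] := W1 x Wx; split => //; left.
  - move=> x y; rewrite negbK => -[Wx|wx] _ ox Uy Ey; last exact: step Ey.
    by left; apply: W2 Uy Ey => //; rewrite negbK.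
  - have key s : Wo (s 0) -> play U (~~ P) sg s -> parity_obj (~~ P) s.
      move=> Ws0 ps; have Ws i : Wo (s i).
        elim: i => // i Wi; have [Es Us sE] := ps i.
        case: (eqVneq (own (s i)) (~~ P)) => os.
          by rewrite sE // sgWE //; case: (W1 _ Wi).
        by apply: W2 Us Es => //; exact: neq_negb.
      apply: W3 => [//|i|i []]; have [? ? sE] := ps i; split => //.
      by move/sE => ->; rewrite sgWE.
    move=> s s0 ps _; have [[k Wk]|nW] := pselect (exists k, Wo (s k)).
      apply: (parity_obj_shift (k := k)); apply: key; first by rewrite addn0.
      exact: play_shift.
    have ws i : winning Z (~~ P) (s i).
      have {}nW i0 : ~ Wo (s i0) by move=> ?; apply: nW; exists i0.
      elim: i => [|i wi]; first by case: s0 => // /nW.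
      have [Es Us sE] := ps i; case: (eqVneq (own (s i)) (~~ P)) => os.
        by rewrite sE //; case: (stepo _ os wi).
      have : own (s i) = P by rewrite -[P]negbK; exact: neq_negb.
      by move=> /step/(_ wi Us Es)[/nW|].
    apply: Z3 => [//|i|i []]; have [? ? sE] := ps i; split => //; first exact: Z0.
    by move/sE => ->; rewrite sgZE // => ?; apply: nW; exists i.
have ZP u : Z u -> winning Z P u.
  move=> Zu; have := Zno u; have [] := IH Z Zlt _ Zu; rewrite /P;
    by case: (odd n) => /= w nw //; case: (nw w).
have [sgZ [Z0 Z1 Z2 Z3]] := winning_strategy Z P.
have [sgA [A0 A1 A2 A3]] := region_strategy U1 N P O0_shift.
have /choice[mv mvP] : forall u, exists u', U1 u -> own u = P -> E u u' /\ U1 u'.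
  move=> u; have [U1u|] := pselect (U1 u); last by exists u.
  have [ou|] := pselect (own u = P); last by exists u.
  by have [u' ? ?] := Pmv _ U1u ou; exists u'.
move=> u Uu nWu.
(* [P] just stays in [U1] from a position of priority [n], approaches such a position inside the
   attractor, and uses the strategy given by induction in [Z]. *)
pose sg x := if `[< N x >] then mv x else if `[< A x >] then sgA x else sgZ x.
have sgN x : N x -> sg x = mv x by move=> Nx; rewrite /sg asboolT.
have sgAE x : ~ N x -> A x -> sg x = sgA x.
  by move=> nN Ax; rewrite /sg asboolF // asboolT.
have sgZE x : Z x -> sg x = sgZ x.
  by move=> [U1x nA]; rewrite /sg asboolF ?asboolF // => -[_ /(NA _ U1x)].
exists U1, sg; split => //; split.
- by move=> x [].
- move=> x U1x _ ox; have [Nx|nN] := pselect (N x).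
    by rewrite sgN //; exact: mvP.
  have [Ax|nA] := pselect (A x).
    by rewrite sgAE //; have [? ?] := A1 _ Ax nN ox; split => //; exact: A0.
  have Zx : Z x by [].
  rewrite sgZE //; have [//|? ?] := Z1 _ (ZP _ Zx) _ ox; split => //.
  by case: (Z0 (sgZ x)).
- by move=> x y U1x _ ox Uy; exact: Pcl.
- move=> s U1s0 ps _.
  have U1s i : U1 (s i).
    elim: i => // i U1i; have [Es Us sE] := ps i.
    case: (eqVneq (own (s i)) P) => os; last first.
      by apply: (Pcl (s i)) => //; exact: neq_negb.
    rewrite sE //; have [Nx|nN] := pselect (N (s i)).
      by rewrite sgN //; case: (mvP _ U1i os).
    have [Ax|nA] := pselect (A (s i)).
      by rewrite sgAE //; have [_ ?] := A1 _ Ax nN os; exact: A0.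
    have Zx : Z (s i) by [].
    by rewrite sgZE //; have [//|_ /Z0[]] := Z1 _ (ZP _ Zx) _ os.
  (* Either [n] recurs and [P] wins, or some tail of the play avoids [N]; it then avoids the
     attractor too, and is a play in [Z]. *)
  have [infN|] := pselect (forall k, exists2 m, k <= m & N (s m)).
    exists n; split => //.
      by move=> k; have [m km [_ prm]] := infN k; exists m.
    by exists 0 => m _; rewrite -ltnS; apply: Un; case: (U1s m).
  move=> /existsNP[k kN]; have nN i : ~ N (s (k + i)).
    by move=> Ni; apply: kN; exists (k + i) => //; exact: leq_addr.
  have Zs i : Z (s (k + i)).
    split => // Ai; pose s' j := s (k + (i + j)).
    apply: (A3 s'); [by rewrite /s' addn0| |by move=> j; exact: nN].
    have As' j : A (s' j).
      elim: j => [|j IHj]; first by rewrite /s' addn0.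
      have [Es Us sE] := ps (k + (i + j)); rewrite /s' !addnS.
      case: (eqVneq (own (s' j)) P) => os.
        by rewrite sE // sgAE //; case: (A1 _ IHj (nN _) os).
      by apply: A2 Es => //; exact: neq_negb.
    move=> j; rewrite /s' !addnS; have [Es Us sE] := ps (k + (i + j)); split => //.
    by move/sE => ->; rewrite sgAE //; exact: As'.
  apply: (parity_obj_shift (k := k)); apply: Z3 => [|i|i []]; first exact: ZP.
  rewrite addnS; have [Es Us sE] := ps (k + i).
  by split => //; [rewrite -addnS|move/sE => ->; rewrite sgZE].
Qed.

End game.

(** * Determinization *)

Definition infinitely_often (P : nat -> Prop) := forall n, exists2 m, n <= m & P m.

Lemma infinitely_often_fin (F : finType) (P : nat -> F -> Prop) :
  infinitely_often (fun n => exists c, P n c) ->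
  exists c, infinitely_often (fun n => P n c).
Proof.
move=> iP; apply: contrapT => nP.
have /choice[N HN] : forall c, exists N, forall m, N <= m -> ~ P m c.
  move=> c; have /existsNP[N HN] : ~ infinitely_often (P^~ c).
    by move=> ic; apply: nP; exists c.
  by exists N => m Nm Pm; apply: HN; exists m.
have [m Nm [c Pc]] := iP (\max_c N c).
by apply: (HN c m) => //; apply: leq_trans Nm; exact: leq_bigmax.
Qed.

Lemma not_infinitely_often (P : nat -> Prop) : ~ infinitely_often P ->
  exists n, forall m, n <= m -> ~ P m.
Proof. by move=> /existsNP[n nP]; exists n => m nm Pm; apply: nP; exists m. Qed.

Section determinization.
Variables (Q : finType) (pri : Q -> nat) (init : pred Q).

Definition segtype := {set Q * {set Q} * Q}.
Implicit Types (s e : segtype) (g : nat -> {set Q * Q}) (L : {set Q * Q}).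

(* The type of a finite word L_0 ... L_(n-1) of relations: the triples
   (r_0, {r_0, ..., r_(n-1)}, r_n) where r follows the relations. *)
Definition emptytype : segtype := [set x | (x.1.1 == x.2) && (x.1.2 == finset.set0)].
Definition steptype (m : segtype) L : segtype :=
  [set x | [exists y, exists S : {set Q},
     [&& (x.1.1, S, y) \in m, (y, x.2) \in L & x.1.2 == y |: S]]].

Definition typ g i j : segtype :=
  foldl (fun m k => steptype m (g k)) emptytype (iota i (j - i)).

Lemma typ_id g i : typ g i i = emptytype.
Proof. by rewrite /typ subnn. Qed.

Lemma typS g i j : i <= j -> typ g i j.+1 = steptype (typ g i j) (g j).
Proof. by move=> ij; rewrite /typ subSn // -addn1 iotaD foldl_cat /= subnKC. Qed.

Lemma typ_eq_le g i i' j n : i <= j -> i' <= j -> typ g i j = typ g i' j ->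
  j <= n -> typ g i n = typ g i' n.
Proof.
move=> ij i'j E /subnK <-; elim: (n - j) => // k IH.
by rewrite addSn !typS ?IH //; apply: leq_trans (leq_addl _ _).
Qed.

Definition follows g (i j : nat) (r : nat -> Q) :=
  forall k, i <= k < j -> (r k, r k.+1) \in g k.

Definition visits (i j : nat) (r : nat -> Q) : {set Q} :=
  [set y | `[< exists2 k, i <= k < j & r k = y >]].

Lemma mem_typ g i j q S q' : i <= j ->
  (q, S, q') \in typ g i j <->
  exists r, [/\ r i = q, r j = q', follows g i j r & S = visits i j r].
Proof.
move=> /subnK <-; elim: (j - i) S q' => [|n IH] S q'.
  rewrite add0n typ_id inE /=; split.
    move=> /andP[/eqP <- /eqP ->]; exists (fun=> q); split => // [k|].
      by rewrite leqNgt andNb.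
    apply/setP => y; rewrite !inE; apply/esym/negbTE; apply/asboolP.
    by move=> [k]; rewrite leqNgt andNb.
  move=> [r [<- <- _ ->]]; rewrite eqxx /=; apply/eqP/setP => y; rewrite !inE.
  by apply/negbTE; apply/asboolP => -[k]; rewrite leqNgt andNb.
rewrite addSn typS ?leq_addl // inE /=; split.
  move=> /existsP[y /existsP[S' /and3P[/IH[r [ri rj rf S'E]] yq' /eqP ->]]].
  pose r' k := if k <= n + i then r k else q'.
  have r'E k : k <= n + i -> r' k = r k by rewrite /r' => ->.
  have r'n : r' (n + i).+1 = q' by rewrite /r' ltnn.
  exists r'; split => //; first by rewrite r'E ?leq_addl.
    move=> k /andP[ik]; rewrite ltnS leq_eqVlt => /predU1P[->|kn].
      by rewrite r'n r'E // rj.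
    by rewrite !r'E //; [apply: rf; rewrite ik|exact: ltnW].
  apply/setP => z; rewrite !inE S'E inE; apply/orP/asboolP.
    move=> [/eqP ->|/asboolP[k /andP[ik kn] <-]].
      by exists (n + i); [rewrite leq_addl ltnSn|rewrite r'E].
    by exists k; [rewrite ik ltnS ltnW|rewrite r'E // ltnW].
  move=> [k /andP[ik]]; rewrite ltnS leq_eqVlt => /predU1P[->|kn] <-.
    by left; rewrite r'E // rj.
  by right; apply/asboolP; exists k; [rewrite ik|rewrite r'E // ltnW].
move=> [r [ri <- rf ->]]; apply/existsP; exists (r (n + i)).
apply/existsP; exists (visits i (n + i) r); apply/and3P; split.
- apply/IH; exists r; split => // k /andP[ik kn].
  by apply: rf; rewrite ik /= ltnW.
- by apply: rf; rewrite leq_addl ltnSn.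
- apply/eqP/setP => z; rewrite !inE; apply/asboolP/orP.
    move=> [k /andP[ik]]; rewrite ltnS leq_eqVlt => /predU1P[->|kn] <-.
      by left.
    by right; apply/asboolP; exists k; [rewrite ik|].
  move=> [/eqP ->|/asboolP[k /andP[ik kn] <-]].
    by exists (n + i); [rewrite leq_addl ltnSn|].
  by exists k; [rewrite ik ltnS ltnW|].
Qed.

Definition maxpri (S : {set Q}) := \max_(q in S) pri q.

Definition universal g := forall r, init (r 0) ->
  (forall i, (r i, r i.+1) \in g i) -> wins true (fun i => pri (r i)).

(* The counterpart of [universal] for an infinite word that is cut into
   a prefix of type s and infinitely many blocks of type e. *)
Definition accept s e := forall q0 S0 (q : nat -> Q) (S : nat -> {set Q}),
  init q0 -> (q0, S0, q 0) \in s -> (forall i, (q i, S i, q i.+1) \in e) ->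
  wins true (fun i => maxpri (S i)).

Lemma wins_visits b (k : nat -> nat) r : (forall i, k i < k i.+1) ->
  wins b (fun i => pri (r i)) <->
  wins b (fun i => maxpri (visits (k i) (k i.+1) r)).
Proof.
move=> kS; apply: (wins_blocks kS) => [i m im|i].
  by apply: leq_bigmax_cond; rewrite inE; apply/asboolP; exists m.
have [|q qS E] := @eq_bigmax_cond _ (mem (visits (k i) (k i.+1) r)) pri.
  apply/card_gt0P; exists (r (k i)); rewrite inE; apply/asboolP.
  by exists (k i); rewrite ?leqnn ?kS.
by move: qS; rewrite inE => /asboolP[m km qE]; exists m; rewrite // qE -E.
Qed.

(** From left to right, runs that witness the types of the segments are glued along the cuts; from
    right to left, a run is cut into the sets of states that its blocks visit. *)
Lemma universal_accept g (k : nat -> nat) s e : (forall i, k i < k i.+1) ->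
  typ g 0 (k 0) = s -> (forall i, typ g (k i) (k i.+1) = e) ->
  universal g <-> accept s e.
Proof.
move=> kS sE eE; split => [ug q0 S0 q S iq0|acc r ir rg].
  rewrite -sE => /mem_typ -/(_ (leq0n _))[r0 [r00 r0k r0f _]] qe.
  have /choice[R HR] : forall i, exists r, [/\ r (k i) = q i, r (k i.+1) = q i.+1,
      follows g (k i) (k i.+1) r & S i = visits (k i) (k i.+1) r].
    by move=> i; apply/mem_typ; [exact: ltnW|rewrite eE].
  have [|r rR] := glue_blocks kS (R := R).
    by move=> i; have [_ -> _ _] := HR i; have [-> _ _ _] := HR i.+1.
  pose r' m := if m < k 0 then r0 m else r m.
  have r'E m : k 0 <= m -> r' m = r m by rewrite /r' ltnNge => ->.
  have ki i : k 0 <= k i by exact: cuts_le.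
  have r'0 m : m <= k 0 -> r' m = r0 m.
    rewrite leq_eqVlt => /predU1P[->|]; last by rewrite /r' => ->.
    by rewrite r'E // (rR 0) ?leqnn ?(ltnW (kS 0)) //; have [-> _ _ _] := HR 0.
  have /wins_visits-/(_ _ kS) : wins true (fun i => pri (r' i)).
    apply: ug; first by rewrite r'0 // r00.
    move=> m; have [mk|km] := ltnP m (k 0).
      by rewrite (r'0 _ (ltnW mk)) (r'0 _ mk); apply: r0f; rewrite mk.
    have [i /andP[im mi]] := cuts_cover kS km.
    rewrite (r'E _ km) (r'E _ (leqW km)) (rR i m) ?im ?(ltnW mi) //.
    rewrite (rR i m.+1) ?mi ?(leqW im) //.
    by have [_ _ Rf _] := HR i; apply: Rf; rewrite im.
  congr (wins _ _); apply/funext => i; congr maxpri.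
  have [_ _ _ ->] := HR i; apply/setP => y; rewrite !inE; apply/asboolP/asboolP.
    move=> [m /andP[im mi] <-]; exists m; rewrite ?im //.
    by rewrite r'E ?(leq_trans (ki i)) // (rR i) // im ltnW.
  move=> [m /andP[im mi] <-]; exists m; rewrite ?im //.
  by rewrite r'E ?(leq_trans (ki i)) // (rR i) // im ltnW.
apply/(wins_visits true r kS); apply: (acc (r 0) (visits 0 (k 0) r) (fun i => r (k i))) => //.
  by rewrite -sE; apply/mem_typ => //; exists r; split => // m _.
by move=> i; rewrite -(eE i); apply/mem_typ; [exact: ltnW|exists r; split => // m _].
Qed.

(** One slot more than there are types: after merging, the representatives have pairwise distinct
    types, so that a slot is always free for a newborn one. *)
Definition slots := #|{: segtype}|.+1.
Notation slot := 'I_slots.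

(* Components of a state: the type of the word read since the birth of each
   live representative; the types between births of representatives; the type
   of the word read before each birth; the type of the whole word; the priority
   of the last step. *)
Definition dstate : finType :=
  ({ffun slot -> option segtype} * {ffun slot * slot -> segtype} *
   {ffun slot -> segtype} * segtype * 'I_(slots.*2.+2))%type.

Implicit Types (d : dstate) (h : slot).
Definition occ d h := d.1.1.1.1 h.
Definition between d hh := d.1.1.1.2 hh.
Definition before d h := d.1.1.2 h.
Definition total d := d.1.2.
Definition dpri d : nat := d.2.

Definition advanced d L h := omap (steptype^~ L) (occ d h).
Definition merged d L h' h :=
  [&& h < h', advanced d L h' & advanced d L h == advanced d L h'].
Definition vacated d L h := [exists h', merged d L h h'].
Definition kept d L h := if vacated d L h then None else advanced d L h.
Definition fresh d L := odflt ord0 [pick h | kept d L h == None].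
Definition good_merge d L h :=
  [exists h', merged d L h' h && `[< accept (before d h) (between d (h, h')) >]].
(** Smaller slots get greater priorities. Vacating a slot is odd and outranks the even priority of a
    good merge into the same slot, but not that of a good merge into a smaller one. *)
Definition step_pri d L :=
  maxn (\max_(h | vacated d L h) (slots - h).*2.+1)
       (\max_(h | good_merge d L h) (slots - h).*2).

Definition dstep d L : dstate :=
  let f := fresh d L in
  ([ffun h => if h == f then Some emptytype else kept d L h],
   [ffun hh => if hh.2 == f then odflt emptytype (kept d L hh.1) else between d hh],
   [ffun h => if h == f then steptype (total d) L else before d h],
   steptype (total d) L,
   inord (step_pri d L)).

Definition dinit : dstate :=
  ([ffun h => if h == ord0 then Some emptytype else None],
   [ffun=> emptytype], [ffun=> emptytype], emptytype, ord0).

Lemma step_pri_lt d L : step_pri d L < slots.*2.+2.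
Proof.
rewrite ltnS geq_max; apply/andP; split; apply/bigmax_leqP => h _.
  by rewrite ltnS leq_double leq_subr.
by rewrite leqW // leq_double leq_subr.
Qed.

Lemma step_priP d L : [\/ step_pri d L = 0,
  exists2 h, vacated d L h & step_pri d L = (slots - h).*2.+1 |
  exists2 h, good_merge d L h & step_pri d L = (slots - h).*2].
Proof.
rewrite /step_pri; set a := bigop.body _ _ _; set b := bigop.body _ _ _.
have aP : a = 0 \/ exists2 h, vacated d L h & a = (slots - h).*2.+1.
  have [h vh|nv] := pickP (vacated d L); last by left; rewrite /a big_pred0.
  have [|h' vh' E] := @eq_bigmax_cond _ (vacated d L) (fun h => (slots - h).*2.+1).
    by apply/card_gt0P; exists h.
  by right; exists h'.
have bP : b = 0 \/ exists2 h, good_merge d L h & b = (slots - h).*2.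
  have [h vh|nv] := pickP (good_merge d L); last by left; rewrite /b big_pred0.
  have [|h' vh' E] := @eq_bigmax_cond _ (good_merge d L) (fun h => (slots - h).*2).
    by apply/card_gt0P; exists h.
  by right; exists h'.
have [ab|ba] := leqP a b.
  by case: bP => [->|?]; [constructor 1|constructor 3].
by case: aP => [->|?]; [constructor 1|constructor 2].
Qed.

(** If no slot were free, the types kept would be pairwise distinct, since slots of equal type are
    merged; but there are fewer types than slots. *)
Lemma kept_fresh d L : kept d L (fresh d L) = None.
Proof.
rewrite /fresh; case: pickP => [h /eqP //|full] /=.
pose F h := odflt emptytype (kept d L h).
have F_inj : injective F.
  move=> h h'; rewrite /F; have := full h; have := full h'.
  case E': (kept d L h') => [m'|//] _; case E: (kept d L h) => [m|//] _ /= mm'.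
  move: E E'; rewrite /kept; case: ifP => // /negbT vh Eh.
  case: ifP => // /negbT vh' Eh'.
  have [hh'|h'h|/val_inj //] := ltngtP h h'.
    case/negP: vh'; apply/existsP; exists h.
    by rewrite /merged hh' Eh Eh' mm' /=.
  case/negP: vh; apply/existsP; exists h'.
  by rewrite /merged h'h Eh Eh' mm' /=.
by have := leq_card F F_inj; rewrite card_ord ltnn.
Qed.

Section run.
Variable g : nat -> {set Q * Q}.

Fixpoint drun n := if n is n'.+1 then dstep (drun n') (g n') else dinit.

Fixpoint birth n h :=
  if n is n'.+1 then if h == fresh (drun n') (g n') then n else birth n' h else 0.

Local Notation vac n := (vacated (drun n) (g n)).
Local Notation mrg n := (merged (drun n) (g n)).

Lemma occS n h : occ (drun n.+1) h =
  if h == fresh (drun n) (g n) then Some emptytype else kept (drun n) (g n) h.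
Proof. by rewrite /occ /= ffunE. Qed.

Lemma total_drun n : total (drun n) = typ g 0 n.
Proof. by elim: n => [|n IH]; rewrite ?typ_id // typS // -IH. Qed.

Lemma kept_some n h m : kept (drun n) (g n) h = Some m ->
  exists2 m', occ (drun n) h = Some m' & m = steptype m' (g n).
Proof.
rewrite /kept /advanced; case: ifP => // _.
by case: (occ _ h) => //= m' [<-]; exists m'.
Qed.

Lemma occ_drun n h m : occ (drun n) h = Some m ->
  [/\ birth n h <= n, m = typ g (birth n h) n &
      before (drun n) h = typ g 0 (birth n h)].
Proof.
elim: n m => [|n IH] m.
  by rewrite /occ /before /= !ffunE; case: ifP => // _ [<-]; rewrite typ_id.
rewrite occS /before /= ffunE; case: ifP => _.
  by move=> [<-]; rewrite typ_id total_drun typS.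
by move=> /kept_some[m' /IH[bn -> ->] ->]; rewrite typS //; split => //; exact: leqW.
Qed.

(** The entry is written at the birth of the younger [h'], when [kept] holds the type of the word
    read since the birth of [h]. *)
Lemma between_drun n h h' m m' : occ (drun n) h = Some m ->
  occ (drun n) h' = Some m' -> birth n h < birth n h' ->
  between (drun n) (h, h') = typ g (birth n h) (birth n h').
Proof.
elim: n m m' => [|n IH] m m' //; rewrite !occS /between /= ffunE /=.
set f := fresh _ _.
have [_ _|_ /[dup] kE /kept_some[m1 o1 m1E]] := eqVneq h f.
  have [_ _|_ /kept_some[m2 /occ_drun[b2 _ _] _]] := eqVneq h' f.
    by rewrite ltnn.
  by rewrite ltnNge leqW.
have [_ _ _|_ /kept_some[m1' o1' _]] := eqVneq h' f; last exact: IH o1 o1'.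
by rewrite kE m1E /=; have [bh -> _] := occ_drun o1; rewrite typS.
Qed.

Lemma occ_persists n h : occ (drun n) h -> ~~ vac n h ->
  occ (drun n.+1) h /\ birth n.+1 h = birth n h.
Proof.
move=> oh nv; have ko : kept (drun n) (g n) h.
  by rewrite /kept (negPf nv) /advanced; case: (occ _ h) oh.
rewrite occS /=; case: eqP => [hf|//]; by rewrite hf kept_fresh in ko.
Qed.

Lemma occ_persists_le N h n : (forall n, N <= n -> ~~ vac n h) ->
  occ (drun N) h -> N <= n -> occ (drun n) h /\ birth n h = birth N h.
Proof.
move=> nv oN /subnK <-; elim: (n - N) => // k [oh bh]; rewrite addSn.
by have [] := occ_persists oh (nv _ (leq_addl _ _)); rewrite bh.
Qed.

Lemma birth_after_vacated n h i : vac n h -> n < i -> occ (drun i) h -> n < birth i h.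
Proof.
move=> vn /subnK <-; elim: (i - n.+1) => [|k IH]; rewrite ?add0n ?addSn occS /=.
  by case: eqP => // _; rewrite /kept vn.
case: eqP => [_ _|_]; first by rewrite ltnS; exact: leq_trans (leqnSn _) (leq_addl _ _).
case kE: kept => [m|//] _; apply: IH.
by have [m' -> _] := kept_some kE.
Qed.

Lemma merged_occ n h h' : mrg n h' h -> occ (drun n) h /\ occ (drun n) h'.
Proof.
rewrite /merged /advanced; case: (occ _ h') => [m'|] /and3P[] //.
by case: (occ _ h).
Qed.

Lemma merged_typ n h h' : mrg n h' h ->
  typ g (birth n h) n.+1 = typ g (birth n h') n.+1.
Proof.
move=> /[dup] /merged_occ[]; rewrite /merged /advanced.
case oE: (occ _ h) => [m|//] _; case oE': (occ _ h') => [m'|//] _ /and3P[_ _].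
have [b mE _] := occ_drun oE; have [b' mE' _] := occ_drun oE'.
by rewrite /= mE mE' => /eqP[E]; rewrite !typS.
Qed.

(* Between two consecutive merges of slot h' into the stable slot h, a new
   representative is born in h'; these births cut the word into blocks of the
   same type. *)
Lemma merged_accept h h' s e : ~ infinitely_often (fun n => vac n h) ->
  infinitely_often (fun n =>
    [/\ mrg n h' h, before (drun n) h = s & between (drun n) (h, h') = e]) ->
  universal g <-> accept s e.
Proof.
move=> /not_infinitely_often[N nv] im.
have /choice[nx nxP] : forall n, exists m, n <= m /\
    [/\ mrg m h' h, before (drun m) h = s & between (drun m) (h, h') = e].
  by move=> n; have [m nm Pm] := im n; exists m.
have [Nn [mN bN _]] := nxP N; set N0 := nx N in Nn mN bN.
have oN0 : occ (drun N0) h by case: (merged_occ mN).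
have stable n : N0 <= n -> occ (drun n) h /\ birth n h = birth N0 h.
  by apply: occ_persists_le oN0 => i Ni; apply/negP/nv; exact: leq_trans Ni.
(* [x] is the birth of the stable representative in [h]; the [v i] are successive merges of [h']
   into [h], and [j i] is the birth of the representative merged at [v i]. *)
pose x := birth N0 h.
pose v := fix v i := if i is i'.+1 then nx (v i').+1 else N0.
have vS i : v i < v i.+1 by have [] := nxP (v i).+1.
have vN i : N0 <= v i by elim: i => // i; move/leq_trans; apply; exact: ltnW.
have vP i : [/\ mrg (v i) h' h, before (drun (v i)) h = s &
                between (drun (v i.+1)) (h, h') = e].
  split; last by have [_ []] := nxP (v i).+1.
    by case: i => [|i] //; have [_ []] := nxP (v i).+1.
  by case: i => [|i] //; have [_ []] := nxP (v i).+1.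
pose j i := birth (v i) h'.
have some_occ n l : occ (drun n) l -> exists m, occ (drun n) l = Some m.
  by case: occ => // m; exists m.
have jv i : j i <= v i.
  have [m _ _] := vP i; have [_ /some_occ[t /occ_drun[]]] := merged_occ m.
  by [].
have vj i : v i < j i.+1.
  apply: birth_after_vacated (vS i) _; last by have [/merged_occ[]] := vP i.+1.
  by have [m _ _] := vP i; apply/existsP; exists h.
have xN0 : x <= N0 by have [t /occ_drun[]] := some_occ _ _ oN0.
have xj i : x < j i.+1 by apply: leq_ltn_trans (vj i); exact: leq_trans (vN i).
have typx i : typ g x (j i.+1) = e.
  have [m _ _] := vP i.+1; have [/some_occ[t ot] /some_occ[t' ot']] := merged_occ m.
  have [_ _ <-] := vP i; rewrite (between_drun ot ot') (stable _ (vN _)).2 //; exact: xj.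
(* The cuts skip [j 0], because the representative merged at [v 0] may be older than [x]. *)
pose cut i := if i is i'.+1 then j i'.+1 else x.
refine (@universal_accept g cut s e _ _ _).
- by case=> [|i]; [exact: xj|exact: leq_ltn_trans (jv i.+1) (vj i.+1)].
- by have [t /occ_drun[_ _ <-]] := some_occ _ _ oN0.
(* The merge at [v i.+1] gives [x] and [j i.+1] the same type up to every later position, so the
   block from [j i.+1] to [j i.+2] has the type of the word from [x] to [j i.+2], which is [e]. *)
- case=> [|i]; first exact: typx.
  rewrite -[RHS](typx i.+1); apply: (@typ_eq_le _ _ _ (v i.+1).+1) => //.
  + exact: leqW (jv _).
  + by apply: leqW; apply: leq_trans (jv i.+1); apply: ltnW.
  + have [m _ _] := vP i.+1; have := merged_typ m.
    by rewrite (stable _ (vN _)).2.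
Qed.

(** A representative is born at every step, so some slot is fresh infinitely often; being occupied
    after each birth, it is vacated before the next. *)
Lemma some_slot_vacated : exists h, infinitely_often (fun n => vac n h).
Proof.
apply: contrapT => nh.
have /choice[N HN] : forall h, exists N, forall n, N <= n -> ~ vac n h.
  by move=> h; apply: not_infinitely_often => ih; apply: nh; exists h.
pose N0 := \max_h N h.
have nv n h : N0 <= n -> ~~ vac n h.
  by move=> Nn; apply/negP/HN; apply: leq_trans Nn; exact: leq_bigmax.
have [|h ih] := @infinitely_often_fin slot (fun n h => h = fresh (drun n) (g n)).
  by move=> n; exists n => //; eexists.
have [n Nn hn] := ih N0; have [m nm hm] := ih n.+1.
have on : occ (drun n.+1) h by rewrite occS -hn eqxx.
have [om _] : occ (drun m) h /\ birth m h = birth n.+1 h.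
  by apply: occ_persists_le on nm => i ni; apply: nv; apply: leq_trans Nn (ltnW ni).
have := kept_fresh (drun m) (g m); rewrite -hm /kept (negPf (nv _ _ _)); last first.
  by apply: leq_trans Nn (leq_trans (leqnSn _) nm).
by rewrite /advanced; case: (occ _ h) om.
Qed.

(** Below the least slot [h0] that is vacated infinitely often, all slots are eventually stable, and
    by [merged_accept] recurring merges into them decide [universal g]. *)
Lemma drun_universal : wins false (fun n => dpri (drun n)) <-> universal g.
Proof.
pose p n := step_pri (drun n) (g n).
(* A state records the priority of the step that led to it, hence the shift by one. *)
have pE n : dpri (drun (1 + n)) = p n.
  by rewrite add1n /dpri /= inordK // step_pri_lt.
have wE b : wins b (fun n => dpri (drun n)) <-> wins b p.
  by rewrite -(wins_shift b 1); have -> : (fun n => dpri (drun (1 + n))) = p by apply/funext.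
have {wE} wE : wins false (fun n => dpri (drun n)) <-> wins false p by exact: wE.
rewrite wE; have [h0 [ih0 minh0]] : exists h0, infinitely_often (fun n => vac n h0) /\
    forall h, h < h0 -> ~ infinitely_often (fun n => vac n h).
  have [h1 ih1] := some_slot_vacated.
  pose P h := `[< infinitely_often (fun n => vac n h) >].
  have Ph1 : P h1 by exact/asboolP.
  have [h0 /asboolP ih0 minh] := arg_minnP (fun h : slot => h : nat) Ph1.
  exists h0; split => // h hh0 /asboolP /minh; by rewrite leqNgt hh0.
have pvac n h : vac n h -> (slots - h).*2.+1 <= p n.
  by move=> vh; rewrite leq_max (@leq_bigmax_cond _ _ (fun h : slot => (slots - h).*2.+1)).
have pgood n h : good_merge (drun n) (g n) h -> (slots - h).*2 <= p n.
  move=> vh; rewrite leq_max; apply/orP; right.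
  exact: (@leq_bigmax_cond _ _ (fun h : slot => (slots - h).*2)).
have [] : wins true p \/ wins false p.
  by apply: (@wins_total _ (slots.*2.+2)) => n; exact/ltnW/step_pri_lt.
(* [h0] keeps merging into a fixed [h < h0] with fixed types. If [g] were universal, these merges
   would be good, so the winning odd priority would exceed theirs and come from a slot at most [h]
   vacated infinitely often, against the choice of [h0]. *)
- move=> wt; split=> [/(wins_excl wt)//|ug]; exfalso.
  have [|[h [s e]] hP] := @infinitely_often_fin (slot * (segtype * segtype))%type
    (fun n c => [/\ mrg n h0 c.1, before (drun n) c.1 = c.2.1 &
                    between (drun n) (c.1, h0) = c.2.2]).
    move=> n; have [m nm /existsP[h mh]] := ih0 n; exists m => //.
    by exists (h, (before (drun m) h, between (drun m) (h, h0))).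
  have hh0 : h < h0 by have [m _ [/and3P[]]] := hP 0.
  have [/(_ ug) acc _] := merged_accept (minh0 _ hh0) hP.
  have [k [ok ik [N bk]]] := wt.
  have hk : (slots - h).*2 <= k.
    have [n Nn [mn bs bb]] := hP N; apply: leq_trans (bk _ Nn); apply: pgood.
    by apply/existsP; exists h0; rewrite mn; apply/asboolP; rewrite bs bb.
  have [|h1 ih1] := @infinitely_often_fin slot
      (fun n h => vac n h /\ k = (slots - h).*2.+1).
    move=> n; have [m nm pm] := ik n; exists m => //; have [] := step_priP (drun m) (g m).
    + by rewrite -/(p m) pm => k0; rewrite k0 in ok.
    + by move=> [h1 ? ?]; exists h1; rewrite -pm.
    + by rewrite -/(p m) pm => -[h1 _ kE]; rewrite kE odd_double in ok.
  have [n _ [_ kE]] := ih1 0; apply: (minh0 h1).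
    by apply: leq_ltn_trans hh0; move: (ltn_ord h1) (ltn_ord h); lia.
  by move=> m; have [i mi []] := ih1 m; exists i.
(* The winning even priority exceeds the odd one of [h0], so it comes from good merges into some
   [h < h0], whose types are accepted. *)
- move=> wf; split=> // _; have [k [ok ik [N bk]]] := wf.
  have hk : (slots - h0).*2.+1 <= k.
    by have [n Nn vn] := ih0 N; apply: leq_trans (bk _ Nn); exact: pvac.
  have [|[h [h' [s e]]] hP] := @infinitely_often_fin (slot * (slot * (segtype * segtype)))%type
      (fun n c => [/\ mrg n c.2.1 c.1, before (drun n) c.1 = c.2.2.1 &
                      between (drun n) (c.1, c.2.1) = c.2.2.2] /\
        (k = (slots - c.1).*2 /\ accept c.2.2.1 c.2.2.2)).
    move=> n; have [m nm pm] := ik n; exists m => //; have [] := step_priP (drun m) (g m).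
    + by rewrite -/(p m) pm => k0; rewrite k0 in hk.
    + by rewrite -/(p m) pm => -[h1 _ kE]; rewrite kE /= odd_double in ok.
    + rewrite -/(p m) pm => -[h /existsP[h' /andP[mh /asboolP acc]] kE].
      by exists (h, (h', (before (drun m) h, between (drun m) (h, h')))).
  have [_ _ [_ /= [kE acc]]] := hP 0.
  have hh0 : h < h0 by move: (ltn_ord h) (ltn_ord h0); lia.
  suff /iffRL : universal g <-> accept s e by apply.
  apply: (@merged_accept h h') => //; first exact: minh0.
  by move=> n; have [m nm []] := hP n; exists m.
Qed.

End run.
End determinization.

(** * Tree automata *)

Section binary_game.
Variables (V : Type) (move_to : V -> V -> V -> Prop) (pr : V -> nat).

Definition pick (d : bool) (p : V * V) := if d then p.2 else p.1.

(** Eve owns [inl v]. Adam's position [inr] keeps [v] along with the pair offered, so that both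
    positions of a round have the same priority. *)
Let position := (V + V * (V * V))%type.
Let owner (p : position) := if p is inl _ then false else true.
Let edge (p p' : position) := match p, p' with
  | inl v, inr (v', (y, z)) => v' = v /\ move_to v y z
  | inr (_, (y, z)), inl v' => v' = y \/ v' = z
  | _, _ => False
  end.
Let priority (p : position) :=
  match p with inl v => pr v | inr (v, _) => pr v end.

Let interleave (s : nat -> V) (m : nat -> V * V) n : position :=
  if odd n then inr (s n./2, m n./2) else inl (s n./2).

Let wins_interleave b s m :
  wins b (fun n => priority (interleave s m n)) -> wins b (fun n => pr (s n)).
Proof.
apply: (iffLR (@wins_blocks (fun i => i.*2) _ b _ _ _ _)) => i.
- by rewrite doubleS.
- move=> n; rewrite doubleS => /andP[i1 i2].
  have -> : priority (interleave s m n) = pr (s n./2).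
    by rewrite /interleave; case: odd.
  have -> // : n./2 = i; move: i1 i2; lia.
- exists i.*2; first by rewrite doubleS leqnn ltnW.
  by rewrite /interleave odd_double doubleK.
Qed.

(* tau may depend on the pair offered by Eve; a play ends only when Eve has no
   pair to offer, and she then loses. *)
Lemma binary_determinacy B : (forall v, pr v <= B) ->
  exists (W : V -> Prop) (sg : V -> V * V) (tau : V -> V -> V -> bool),
  [/\ forall v, W v -> [/\ move_to v (sg v).1 (sg v).2, W (sg v).1 & W (sg v).2],
      forall (s : nat -> V) (d : nat -> bool), W (s 0) ->
        (forall i, s i.+1 = pick (d i) (sg (s i))) ->
        wins false (fun i => pr (s i)) &
      forall (s y z : nat -> V), ~ W (s 0) ->
        (forall i, move_to (s i) (y i) (z i) /\
           s i.+1 = pick (tau (s i) (y i) (z i)) (y i, z i)) ->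
        wins true (fun i => pr (s i))].
Proof.
move=> prB.
have [sE [_ E1 E2 E3]] := winning_strategy owner edge priority (fun=> True) false.
have [sA [_ A1 A2 A3]] := winning_strategy owner edge priority (fun=> True) true.
have det p : winning owner edge priority (fun=> True) true p \/
             winning owner edge priority (fun=> True) false p.
  apply: (@positional_determinacy _ owner edge priority B.+1) => // -[v|[v yz]] _ /=;
  by rewrite ltnS.
pose W v := winning owner edge priority (fun=> True) false (inl v).
(* The pair [(v, v)] is a default value: on [W] the strategy [sE] always returns an [inr]. *)
pose sg v := if sE (inl v) is inr (_, yz) then yz else (v, v).
pose tau v y z := `[< sA (inr (v, (y, z))) = inl z >].
have WE v : W v -> sE (inl v) = inr (v, sg v) /\
    [/\ move_to v (sg v).1 (sg v).2, W (sg v).1 & W (sg v).2].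
  move=> Wv; have [//|//|] := E1 _ Wv.
  rewrite /sg /=; case: (sE (inl v)) => [//|[v' [y z]]] [-> mv] Ws; split => //.
  by split => //; apply: (E2 _ _ Ws) => //=; [left|right].
exists W, sg, tau; split.
- by move=> v /WE[].
- move=> s d W0 sS.
  have Ws i : W (s i).
    elim: i => // i /WE[_ [_ ? ?]]; rewrite sS /pick; by case: (d i).
  apply: (@wins_interleave _ s (fun i => sg (s i))).
  apply: (E3 (interleave s (fun i => sg (s i)))) => [//|i|i []].
  rewrite /interleave /=; case: (boolP (odd i)) => oi /=.
    rewrite uphalf_half oi /= add1n sS /pick; split => //.
    by case: (sg _) => y z /=; case: (d _); [right|left].
  have [sEE [mv _ _]] := WE _ (Ws i./2).
  rewrite uphalf_half (negPf oi) /= add0n; split => //.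
  by move: mv; case: (sg _).
- move=> s y z nW0 ms; pose m i := (y i, z i).
  have [w0|/nW0 //] := det (inl (s 0)).
  pose Wi n := winning owner edge priority (fun=> True) true (interleave s m n).
  have tauE i : Wi i.*2.+1 -> sA (inr (s i, (y i, z i))) = inl (s i.+1).
    rewrite /Wi /interleave /= odd_double /= uphalf_double => wi.
    have [//|//|] := A1 _ wi; have [_ ->] := ms i; rewrite /pick /tau /m.
    by case sAE: (sA _) => [u|//] /= [->|->] _; case: asboolP.
  have Ws n : Wi n.
    elim: n => [//|n IH]; rewrite -[n](odd_double_half n) in IH *.
    case: (odd n) IH; rewrite ?add1n ?add0n => IH.
      have := A1 _ IH; rewrite /Wi /interleave /= !odd_double /= doubleK uphalf_double.
      by move=> [//|//|_]; rewrite (tauE _ IH).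
    apply: (A2 _ _ IH) => //; rewrite /interleave /= ?odd_double //= doubleK uphalf_double.
    by case: (ms n./2).
  apply: (@wins_interleave _ s m).
  apply: (A3 (interleave s m)) => [//|i|i []].
  rewrite -[i](odd_double_half i); case: (odd i); rewrite ?add1n ?add0n.
    rewrite /interleave /= !odd_double /= doubleK uphalf_double; split => //.
      by have [_ ->] := ms i./2; rewrite /pick; case: (tau _ _ _); [right|left].
    by move=> _; rewrite tauE.
  rewrite /interleave /= !odd_double /= doubleK uphalf_double; split => //.
  by case: (ms i./2).
Qed.

End binary_game.

(** * Parity tree automata: complement, union, nonemptiness *)

Lemma tree_rec (S : Type) (s0 : S) (f : vertex -> S -> bool -> S) :
  exists rho : vertex -> S,
    rho [::] = s0 /\ forall w d, rho (rcons w d) = f w (rho w) d.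
Proof.
(* The fold also carries the vertex reached, on which [f] depends. *)
pose F := foldl (fun p d => (rcons p.1 d, f p.1 p.2 d)) ([::] : vertex, s0).
have F1 w : (F w).1 = w.
  by elim/last_ind: w => // w d IH; rewrite /F foldl_rcons -/(F w) /= IH.
exists (fun w => (F w).2); split => // w d.
by rewrite {1}/F foldl_rcons -/(F w) /= F1.
Qed.

Lemma branch_rec (f : vertex -> bool) :
  exists x : branch, forall n, x n = f (mkseq x n).
Proof.
pose v := fix v n : vertex := if n is n'.+1 then rcons (v n') (f (v n')) else [::].
exists (fun n => f (v n)) => n; congr f.
by elim: n => // n IH; rewrite mkseqSr -IH.
Qed.

(** Only the states have to be finite. The alphabet is arbitrary, so that one letter can give the
    values of infinitely many variables. *)
Record automaton (A : Type) := Automaton {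
  state : finType;
  initial : pred state;
  transition : state -> A -> state -> state -> Prop;
  prio : state -> nat }.

Section automata.
Context {A : Type}.
Implicit Types (M N : automaton A) (t : vertex -> A).

Definition run M t (rho : vertex -> state M) :=
  [/\ initial (rho [::]),
      forall w, transition (rho w) (t w) (rho (rcons w false)) (rho (rcons w true)) &
      forall x : branch, wins false (fun n => prio (rho (mkseq x n)))].

Definition accepts M t := exists rho, @run M t rho.

Lemma prio_bound M : exists B, forall q : state M, prio q <= B.
Proof. by exists (\max_(q : state M) prio q) => q; exact: leq_bigmax. Qed.

Lemma run_branch M t rho (f : vertex -> bool) : @run M t rho ->
  exists x : branch, [/\ forall n, x n = f (mkseq x n),
    forall n, rho (mkseq x n.+1) =
      if x n then rho (rcons (mkseq x n) true) else rho (rcons (mkseq x n) false) &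
    wins false (fun n => prio (rho (mkseq x n)))].
Proof.
move=> [_ _ acc]; have [x xE] := branch_rec f; exists x; split => // n.
by rewrite mkseqSr; case: (x n).
Qed.

(* The complement guesses a positional strategy f of Adam, as a labelling of the
   tree, and checks deterministically along each branch that Adam wins every
   play that stays on this branch. *)
Definition moves M (a : A) (f : state M -> state M -> state M -> bool) (d : bool) :
    {set state M * state M} :=
  [set p | `[< exists l r, [/\ transition p.1 a l r, f p.1 l r = d &
                               p.2 = if d then r else l] >]].

Definition complement M : automaton A :=
  @Automaton A (dstate (state M))
    (fun s => s == dinit _)
    (fun s a s0 s1 => exists f, s0 = dstep (@prio _ M) (@initial _ M) s (moves a f false) /\
                                s1 = dstep (@prio _ M) (@initial _ M) s (moves a f true))
    (@dpri _).

(** Against a run of [M], the guessed answers of Adam single out a branch whose play both players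
    would win. Conversely, if [M] rejects, Adam's positional strategy in the acceptance game
    supplies the guesses. *)
Lemma accepts_complement M t : accepts (complement M) t <-> ~ accepts M t.
Proof.
have key f (rho : vertex -> state (complement M)) (x : branch) :
  rho [::] = dinit _ -> (forall w d, rho (rcons w d) =
    dstep (@prio _ M) (@initial _ M) (rho w) (moves (t w) (f w) d)) ->
  wins false (fun n => prio (rho (mkseq x n))) <->
  universal (@prio _ M) (@initial _ M)
    (fun n => moves (t (mkseq x n)) (f (mkseq x n)) (x n)).
  move=> rho0 rhoS; rewrite -drun_universal.
  set u := fun n => _; set v := fun n => _; suff -> : u = v by [].
  apply/funext => n; rewrite /u /v; congr dpri.
  by elim: n => [//|n IH]; rewrite mkseqSr rhoS IH.
split.
  move=> [rho [/eqP rho0 rhoT acc]] [r rP].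
  have /choice[f fP] := rhoT.
  have [x [xE rx wx]] := run_branch
    (fun w => f w (r w) (r (rcons w false)) (r (rcons w true))) rP.
  apply: wins_excl wx; have [r0 rT _] := rP.
  have /(key f) : forall w d, rho (rcons w d) =
      dstep (@prio _ M) (@initial _ M) (rho w) (moves (t w) (f w) d).
    by move=> w d; have [e0 e1] := fP w; case: d; [exact: e1|exact: e0].
  move=> /(_ x rho0)[/(_ (acc x)) + _]; apply => // n.
  rewrite inE; apply/asboolP.
  exists (r (rcons (mkseq x n) false)), (r (rcons (mkseq x n) true)).
  split; [exact: rT|by rewrite [RHS]xE|by rewrite rx].
move=> nacc; have [B prB] := prio_bound M.
(* Positions of the acceptance game are pairs of a vertex and a state, so a positional strategy of
   Adam is a labelling of the tree. *)
pose mv (p y z : vertex * state M) := [/\ transition p.2 (t p.1) y.2 z.2,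
  y.1 = rcons p.1 false & z.1 = rcons p.1 true].
have [W [sg [tau [W1 W2 W3]]]] := @binary_determinacy _ mv (fun p => prio p.2) B
  (fun p => prB p.2).
(* If Eve won from an initial state, her strategy would unfold into an accepting run. *)
have nW q : initial q -> ~ W ([::], q).
  move=> iq Wq; apply: nacc.
  have [rho [rho0 rhoS]] := tree_rec ([::], q) (fun _ p d => pick d (sg p)).
  have Wr w : W (rho w).
    elim/last_ind: w => [|w d IH]; first by rewrite rho0.
    by rewrite rhoS; case: (W1 _ IH) => _; case: d.
  have r1 w : (rho w).1 = w.
    elim/last_ind: w => [|w d IH]; first by rewrite rho0.
    by rewrite rhoS; case: (W1 _ (Wr w)) => -[_ y1 z1] _ _; case: d; rewrite /= ?y1 ?z1 IH.
  exists (fun w => (rho w).2); split; first by rewrite rho0.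
    by move=> w; rewrite !rhoS; case: (W1 _ (Wr w)) => -[]; rewrite r1.
  move=> x; apply: (W2 (fun n => rho (mkseq x n)) x) => //.
  by move=> i; rewrite mkseqSr rhoS.
pose f w q l r := tau (w, q) (rcons w false, l) (rcons w true, r).
have [rho [rho0 rhoS]] := tree_rec (dinit _ : state (complement M))
  (fun w s d => dstep (@prio _ M) (@initial _ M) s (moves (t w) (f w) d)).
exists rho; split; first by rewrite rho0 /= eqxx.
  by move=> w; exists (f w); rewrite !rhoS.
move=> x; apply/(key f) => // r ir rm.
have /choice[ly /choice[lz lyz]] : forall n, exists l r',
    [/\ transition (r n) (t (mkseq x n)) l r',
    f (mkseq x n) (r n) l r' = x n & r n.+1 = if x n then r' else l].
  by move=> n; have := rm n; rewrite inE => /asboolP.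
apply: (W3 (fun n => (mkseq x n, r n)) (fun n => (rcons (mkseq x n) false, ly n))
           (fun n => (rcons (mkseq x n) true, lz n))); first exact: nW.
move=> n; have [tl fx rE] := lyz n; split => //.
by rewrite -/(f _ _ _ _) fx rE mkseqSr; case: (x n).
Qed.

Definition union M N : automaton A :=
  @Automaton A (state M + state N)%type
    (fun s => match s with inl p => initial p | inr q => initial q end)
    (fun s a l r => match s, l, r with
       | inl p, inl pl, inl pr => transition p a pl pr
       | inr q, inr ql, inr qr => transition q a ql qr
       | _, _, _ => False end)
    (fun s => match s with inl p => prio p | inr q => prio q end).

Lemma accepts_union M N t : accepts (union M N) t <-> accepts M t \/ accepts N t.
Proof.
split=> [[rho [rho0 rhoT acc]]|[[rho [rho0 rhoT acc]]|[rho [rho0 rhoT acc]]]].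
- case rE : (rho [::]) => [p0|p0]; [left|right].
  + have /choice[r rhoE] : forall w, exists p, rho w = inl p.
      elim/last_ind => [|w d [p IH]]; first by exists p0.
      have := rhoT w; rewrite /= IH; case E0: (rho (rcons w false)) => [q0|//].
      by case E1: (rho (rcons w true)) => [q1|//] _; case: d; eexists; eassumption.
    exists r; split; first by move: rho0; rewrite /= rhoE.
      by move=> w; have := rhoT w; rewrite /= !rhoE.
    by move=> x; apply: wins_ext (acc x) => n; rewrite rhoE.
  + have /choice[r rhoE] : forall w, exists p, rho w = inr p.
      elim/last_ind => [|w d [p IH]]; first by exists p0.
      have := rhoT w; rewrite /= IH; case E0: (rho (rcons w false)) => [//|q0].
      by case E1: (rho (rcons w true)) => [//|q1] _; case: d; eexists; eassumption.
    exists r; split; first by move: rho0; rewrite /= rhoE.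
      by move=> w; have := rhoT w; rewrite /= !rhoE.
    by move=> x; apply: wins_ext (acc x) => n; rewrite rhoE.
- by exists (fun w => inl (rho w)).
- by exists (fun w => inr (rho w)).
Qed.

(** The state is a bit handed down by the parent, [false] at the root; with the constant priority 0,
    only the local constraints matter. *)
Definition local_check (check : bool -> A -> Prop) (next : A -> bool -> bool) :
    automaton A :=
  @Automaton A bool negb
    (fun s a l r => [/\ check s a, l = next a false & r = next a true]) (fun=> 0).

Lemma accepts_local_check check next t :
  accepts (local_check check next) t <->
  check false (t [::]) /\ forall w d, check (next (t w) d) (t (rcons w d)).
Proof.
split=> [[rho [rho0 rhoT _]]|[c0 cS]].
  split; first by have [] := rhoT [::]; rewrite (negbTE rho0).
  move=> w d; have [_ E0 E1] := rhoT w; have [] := rhoT (rcons w d).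
  by case: d; rewrite ?E0 ?E1.
have [rho [rho0 rhoS]] := tree_rec false (fun w _ d => next (t w) d).
exists rho; split; first by rewrite rho0.
  move=> w; split; rewrite ?rhoS //.
  by case/lastP: w => [|w d]; rewrite ?rho0 ?rhoS.
by move=> x; exists 0; split => // [n|]; exists n || exists 0.
Qed.

(** Eve wins the game in which she chooses a letter and two successor states, since the given run
    beats Adam's strategy. The positions are the states, so her positional strategy is a finite
    transition function that generates the tree. *)
Lemma nonempty_regular M t : accepts M t ->
  exists (Q : finType) (q0 : Q) (next : Q -> bool -> Q) (lab : Q -> A),
    accepts M (fun w => lab (foldl next q0 w)).
Proof.
move=> [rho rhoP]; have [rho0 rhoT acc] := rhoP; have [B prB] := prio_bound M.
pose mv (p y z : state M) := exists a, transition p a y z.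
have [W [sg [tau [W1 W2 W3]]]] := @binary_determinacy _ mv (@prio _ M) B prB.
pose q0 := rho [::].
have Wq0 : W q0.
  apply: contrapT => nW.
  have [x [xE rx]] := run_branch
    (fun w => tau (rho w) (rho (rcons w false)) (rho (rcons w true))) rhoP.
  apply: wins_excl.
  apply: (W3 (fun n => rho (mkseq x n)) (fun n => rho (rcons (mkseq x n) false))
    (fun n => rho (rcons (mkseq x n) true))) => // n; split.
    by exists (t (mkseq x n)).
  by rewrite rx xE /pick; case: (tau _ _ _).
have /choice[lab labP] : forall q, exists a, W q -> transition q a (sg q).1 (sg q).2.
  move=> q; have [/W1[[a ?] _ _]|nW] := pselect (W q); first by exists a.
  by exists (t [::]).
exists (state M), q0, (fun q d => pick d (sg q)), lab.
have Wr w : W (foldl (fun q d => pick d (sg q)) q0 w).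
  elim/last_ind: w => // w d /W1[_ ? ?].
  by rewrite foldl_rcons /pick; case: d.
exists (foldl (fun q d => pick d (sg q)) q0); split => //.
  by move=> w; rewrite !foldl_rcons; exact/labP/Wr.
move=> x; apply: (W2 (fun n => foldl _ q0 (mkseq x n)) x) => // n.
by rewrite mkseqSr foldl_rcons.
Qed.

End automata.

(** * Projection and relabelling of the input tree *)

Section relabellings.
Variables (A C : Type) (M : automaton C).

Definition project (R : A -> C -> Prop) : automaton A :=
  @Automaton A (state M) (@initial _ M)
    (fun q a l r => exists2 c, R a c & transition q c l r) (@prio _ M).

Lemma accepts_project R t :
  accepts (project R) t <-> exists2 u, (forall w, R (t w) (u w)) & accepts M u.
Proof.
split=> [[rho [rho0 rhoT acc]]|[u Ru [rho [rho0 rhoT acc]]]].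
  have /choice[u uP] : forall w, exists c, R (t w) c /\
      @transition C M (rho w) c (rho (rcons w false)) (rho (rcons w true)).
    by move=> w; have [c ? ?] := rhoT w; exists c.
  by exists u => [w|]; [case: (uP w)|exists rho; split => // w; case: (uP w)].
by exists rho; split => // w; exists (u w).
Qed.

(** The second component of the state holds exactly at the root. This marks the vertex that all
    first-order variables denote in [defined_set]. *)
Definition relabel_root (f : bool -> A -> C) : automaton A :=
  @Automaton A (state M * bool)%type (fun q => initial q.1 && q.2)
    (fun q a l r => [/\ transition q.1 (f q.2 a) l.1 r.1, ~~ l.2 & ~~ r.2])
    (fun q => prio q.1).

Lemma accepts_relabel_root f t :
  accepts (relabel_root f) t <-> accepts M (fun w => f (w == [::]) (t w)).
Proof.
split=> [[rho [/andP[rho0 b0] rhoT acc]]|[rho [rho0 rhoT acc]]].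
  exists (fun w => (rho w).1); split => // w; have [] := rhoT w.
  suff -> : (rho w).2 = (w == [::]) by [].
  case/lastP: w => [|w d] //; have [_ l r] := rhoT w.
  by rewrite -size_eq0 size_rcons /=; case: d; apply/negbTE.
exists (fun w => (rho w, w == [::])); split => //.
- by rewrite /= rho0.
- move=> w; have rc d : (rcons w d == [::]) = false by rewrite -size_eq0 size_rcons.
  by split; rewrite /= ?rc.
Qed.

(* The boolean component of a state tells whether the distinguished vertex lies
   in the current subtree; priority 1 forbids postponing it forever. *)
Definition point (f : bool -> A -> C) : automaton A :=
  @Automaton A (state M * bool)%type (fun q => initial q.1 && q.2)
    (fun q a l r => exists2 here, transition q.1 (f here a) l.1 r.1 &
       (here, l.2, r.2) \in if q.2
         then [:: (true, false, false); (false, true, false); (false, false, true)]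
         else [:: (false, false, false)])
    (fun q => if q.2 then 1 else prio q.1).

Lemma accepts_point f t :
  accepts (point f) t <-> exists v, accepts M (fun w => f (w == v) (t w)).
Proof.
split=> [[rho [/andP[rho0 b0] rhoT acc]]|[v [rho [rho0 rhoT acc]]]]; last first.
  exists (fun w => (rho w, prefix w v)); split.
  - by rewrite /= rho0 prefix0s.
  - move=> w; exists (w == v) => //=.
    have [/prefixP[s ->]|nwv] := boolP (prefix w v); last first.
      have nw d : prefix (rcons w d) v = false.
        by apply: contraNF nwv; apply: prefix_trans; rewrite -cats1 prefix_prefix.
      rewrite !nw; suff -> : (w == v) = false by [].
      by apply: contraNF nwv => /eqP ->; exact: prefix_refl.
    have -> : (w == w ++ s) = (s == [::]).
      by rewrite -{1}[w]cats0 eqseq_cat // eqxx eq_sym.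
    rewrite -!cats1 !prefix_catr // eqxx.
    by case: s => [|[] s] //=; rewrite ?prefix0s.
  (* Beyond depth [size v] no vertex is a prefix of [v], and the priorities are those of [rho]. *)
  - move=> x; apply: (iffLR (wins_shift false (size v).+1 _)).
    have := iffRL (wins_shift false (size v).+1 _) (acc x); apply: wins_ext => n /=.
    by case: ifP => // /size_prefix; rewrite size_mkseq addSn ltnNge leq_addr.
have /choice[here hereP] : forall w, exists h,
    transition (rho w).1 (f h (t w)) (rho (rcons w false)).1 (rho (rcons w true)).1 /\
    (h, (rho (rcons w false)).2, (rho (rcons w true)).2) \in if (rho w).2
      then [:: (true, false, false); (false, true, false); (false, false, true)]
      else [:: (false, false, false)].
  by move=> w; have [h ? ?] := rhoT w; exists h.
pose b w := (rho w).2.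
have bF w : ~~ b w -> ~~ here w /\ forall d, ~~ b (rcons w d).
  move=> /negbTE bw; have [_] := hereP w; rewrite -!/(b _) bw inE.
  by move=> /eqP[-> E0 E1]; split => //; case; rewrite ?E0 ?E1.
have bT w : b w -> if here w then forall d, ~~ b (rcons w d)
    else exists d, forall d', b (rcons w d') = (d' == d).
  move=> bw; have [_] := hereP w; rewrite -!/(b _) bw !inE => /or3P[]/eqP[-> E0 E1].
  - by case; rewrite ?E0 ?E1.
  - by exists false; case; rewrite ?E0 ?E1.
  - by exists true; case; rewrite ?E0 ?E1.
have bS w d : b (rcons w d) -> b w.
  by apply: contraLR => /bF[_]; exact.
(* If no vertex were distinguished, following the child that carries the bit would give a branch of
   constant priority 1, won by Adam. *)
have [v hv] : exists v, here v.
  apply: contrapT => nh; have {}nh w : here w = false.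
    by apply/negP => hw; apply: nh; exists w.
  have [x xE] := branch_rec (fun w => b (rcons w true)).
  have bx n : b (mkseq x n).
    elim: n => [|n IH]; first exact: b0.
    rewrite mkseqSr; have := bT _ IH; rewrite nh => -[d dE]; rewrite dE.
    by rewrite xE dE; case: d {dE}.
  apply: (@wins_excl (fun=> 1)); last by apply: wins_ext (acc x) => n; rewrite /= -/(b _) bx.
  by exists 1; split => // [n|]; [exists n|exists 0].
have anc w s : v = w ++ s -> b w.
  have bv : b v by apply: contraLR hv => /bF[].
  elim/last_ind: s w => [|s d IH] w vE; first by rewrite -[w]cats0 -vE.
  suff : b (w ++ s).
    elim/last_ind: s {IH vE} => [|s d' IH]; first by rewrite cats0.
    by rewrite -rcons_cat => /bS.
  by apply: (bS _ d); rewrite rcons_cat -vE.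
have onpath w : b w -> prefix w v.
  elim/last_ind: w => [|w d IH] bw; first exact: prefix0s.
  have /prefixP[[|d' s] vE] := IH (bS _ _ bw).
    have := bT _ (bS _ _ bw); have <- : v = w by rewrite vE cats0.
    rewrite hv => /(_ d)/negP; case; by move: bw; have -> : w = v by rewrite vE cats0.
  have bd' : b (rcons w d') by apply: (anc _ s); rewrite cat_rcons.
  have := bT _ (bS _ _ bw); case: (here w) => [/(_ d)/negP //|[d0 dE]].
  move: bw bd'; rewrite !dE => /eqP -> /eqP E; rewrite vE -E -cat_rcons.
  exact: prefix_prefix.
have hereE w : here w = (w == v).
  apply/idP/eqP => [hw|-> //].
  have bw : b w by apply: contraLR hw => /bF[].
  have /prefixP[[|d s] vE] := onpath _ bw; first by rewrite vE cats0.
  have := bT _ bw; rewrite hw => /(_ d)/negP; case.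
  by apply: (anc _ s); rewrite cat_rcons.
exists v, (fun w => (rho w).1); split => //.
  by move=> w; have [T _] := hereP w; rewrite -hereE.
move=> x; apply: (iffLR (wins_shift false (size v).+1 _)).
have := iffRL (wins_shift false (size v).+1 _) (acc x); apply: wins_ext => n /=.
rewrite -/(b _); case: ifP => // /onpath /size_prefix.
by rewrite size_mkseq addSn ltnNge leq_addr.
Qed.

End relabellings.

(** * From formulas to automata *)

Definition letter := ((nat -> bool) * (nat -> bool))%type.

Definition labelling (e1 : nat -> vertex) (e2 : nat -> set vertex) (w : vertex) : letter :=
  (fun x => w == e1 x, fun X => `[< e2 X w >]).

(** Induction on the formula: [complement], [union], [point] and [project] treat negation,
    disjunction and the two existential quantifiers; a universal quantifier is an existential one
    between two complements. *)
Lemma S2S_automaton (R : realType) phi : is_S2S phi ->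
  exists M : automaton letter, forall e1 e2,
    accepts M (labelling e1 e2) <-> sat R phi e1 e2.
Proof.
have compl M (P : (nat -> vertex) -> (nat -> set vertex) -> Prop) :
    (forall e1 e2, accepts M (labelling e1 e2) <-> P e1 e2) ->
    forall e1 e2, accepts (complement M) (labelling e1 e2) <-> ~ P e1 e2.
  by move=> MP e1 e2; rewrite accepts_complement MP.
have ex1 x M (P : (nat -> vertex) -> (nat -> set vertex) -> Prop) :
    (forall e1 e2, accepts M (labelling e1 e2) <-> P e1 e2) ->
    exists M' : automaton letter, forall e1 e2,
      accepts M' (labelling e1 e2) <-> exists v, P (update e1 x v) e2.
  move=> MP; exists (point M (fun here (a : letter) => (update a.1 x here, a.2))) => e1 e2.
  have E v : (fun w => (update (labelling e1 e2 w).1 x (w == v), (labelling e1 e2 w).2)) =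
      labelling (update e1 x v) e2.
    apply/funext => w; congr pair; apply/funext => y; rewrite /update /=.
    by case: eqP.
  by rewrite accepts_point; split=> -[v Hv]; exists v; move: Hv; rewrite E => /MP.
have ex2 X M (P : (nat -> vertex) -> (nat -> set vertex) -> Prop) :
    (forall e1 e2, accepts M (labelling e1 e2) <-> P e1 e2) ->
    exists M' : automaton letter, forall e1 e2,
      accepts M' (labelling e1 e2) <-> exists V, P e1 (update e2 X V).
  move=> MP; exists (project M (fun a c : letter =>
    a.1 = c.1 /\ exists b, c.2 = update a.2 X b)) => e1 e2.
  rewrite accepts_project; split=> [[u uR Mu]|[V /MP MV]].
    exists [set w | (u w).2 X]%classic; apply/MP; move: Mu; congr accepts; apply/funext => w.
    have [E1 [b E2]] := uR w; rewrite [u w]surjective_pairing -E1 E2; congr pair.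
    apply/funext => Y; rewrite /update /=; case: eqP => // _.
    have -> : b = (u w).2 X by rewrite E2 /update eqxx.
    by rewrite asboolb.
  exists (labelling e1 (update e2 X V)) => // w; split => //; exists `[< V w >].
  by apply/funext => Y; rewrite /update /=; case: eqP.
elim: phi => [x y|x y|x X|phi IH|phi IHp psi IHq|x phi IH|x phi IH|X phi IH|X phi IH|//] /=.
(* The bit sent to a child says that it is the left child of [e1 x]; such a child is required to be
   [e1 y]. *)
- move=> _; exists (local_check (fun s (a : letter) => s ==> a.1 y)
    (fun a d => a.1 x && ~~ d)) => e1 e2; rewrite accepts_local_check /=.
  split=> [[_ /(_ (e1 x) false)]|yx]; first by rewrite eqxx => /eqP.
  split=> // w d; apply/implyP => /andP[/eqP -> /negbTE ->]; exact/eqP.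
- move=> _; exists (local_check (fun s (a : letter) => s ==> a.1 y)
    (fun a d => a.1 x && d)) => e1 e2; rewrite accepts_local_check /=.
  split=> [[_ /(_ (e1 x) true)]|yx]; first by rewrite eqxx => /eqP.
  split=> // w d; apply/implyP => /andP[/eqP -> ->]; exact/eqP.
- move=> _; exists (local_check (fun s (a : letter) => a.1 x ==> a.2 X)
    (fun a d => false)) => e1 e2; rewrite accepts_local_check /=.
  split=> [[c0 cS]|xX].
    have H w : (w == e1 x) ==> `[< e2 X w >] by case/lastP: w.
    by have := H (e1 x); rewrite eqxx => /asboolP.
  by split=> [|w d]; apply/implyP => /eqP ->; apply/asboolP.
- by move=> /IH[M /compl MP]; exists (complement M).
- move=> /andP[/IHp[M MP] /IHq[N NP]]; exists (union M N) => e1 e2.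
  by rewrite accepts_union MP NP.
- by move=> /IH[M /(ex1 x)].
- move=> /IH[M /compl /(ex1 x)[N /compl NP]]; exists (complement N) => e1 e2.
  rewrite NP; split=> [nE v|H [v]]; last by apply; exact: H.
  by apply: contrapT => nv; apply: nE; exists v.
- by move=> /IH[M /(ex2 X)].
- move=> /IH[M /compl /(ex2 X)[N /compl NP]]; exists (complement N) => e1 e2.
  rewrite NP; split=> [nE v|H [v]]; last by apply; exact: H.
  by apply: contrapT => nv; apply: nE; exists v.
Qed.

(* Rabin's basis theorem for one set variable. *)
Lemma S2S_regular_model (R : realType) phi (t : 'I_1 -> set vertex) :
  is_S2S phi -> defined_set R phi t ->
  exists (Q : finType) (q0 : Q) (next : Q -> bool -> Q) (lab : Q -> bool),
    defined_set R phi (fun _ : 'I_1 => [set w | lab (foldl next q0 w)]%classic).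
Proof.
move=> /(S2S_automaton R)[M MP] phit.
(* In the environments of [defined_set], every first-order variable marks the root, and only the set
   variable 0 can be nonempty. *)
pose f root (b : bool) : letter := (fun=> root, fun X => (X == 0) && b).
have fE (X : set vertex) : (fun w => f (w == [::]) `[< X w >]) =
    labelling (fun=> [::]) (tuple_env (fun _ : 'I_1 => X)).
  apply/funext => w; congr pair; apply/funext => Y; rewrite /tuple_env.
  case: insubP => [[[|//] Y0] _ /= <- //|]; rewrite ltnS leqn0 => /negbTE -> /=.
  by apply/esym/asboolP.
have tE : t = fun=> t ord0 by apply/funext => i; rewrite [i]ord1.
have [] := @nonempty_regular _ (relabel_root M f) (fun w => `[< t ord0 w >]).
  by rewrite accepts_relabel_root fE MP -tE.
move=> Q [q0 [next [lab acc]]]; exists Q, q0, next, lab.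
move: acc; rewrite accepts_relabel_root /defined_set /= -MP -fE.
by congr accepts; apply/funext => w; rewrite asboolb.
Qed.

(** * Random paths *)

Import Order.TTheory GRing.Theory Num.Theory.
Import numFieldNormedType.Exports.
Local Open Scope classical_set_scope.

(** Nonempty sets closed under children replace subtrees, so that [dense_formula] can do without the
    prefix order. *)
Definition dense_in_tree (X : set vertex) : Prop :=
  forall Z : set vertex, (exists v, Z v) ->
    (forall v d, Z v -> Z (rcons v d)) -> exists v, Z v /\ X v.

Definition hitting (X : set vertex) : set branch :=
  [set x | exists n, X (mkseq x n)].

Definition meets_formula (Y X : nat) : formula :=
  Exists1 0 (Not (Or (Not (Defs.Mem 0 Y)) (Not (Defs.Mem 0 X)))).

Definition leaves_formula (Y : nat) : formula :=
  Exists1 0 (Exists1 1 (Not (Or (Not (Defs.Mem 0 Y))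
    (Or (Defs.Mem 1 Y) (Not (Or (SuccL 0 1) (SuccR 0 1))))))).

(** The three disjuncts: the set 1 is empty, it is not closed under children, or it meets the set
    0. *)
Definition dense_formula : formula :=
  Forall2 1 (Or (Not (Exists1 0 (Defs.Mem 0 1)))
    (Or (leaves_formula 1) (meets_formula 1 0))).

Definition witness_formula : formula :=
  Not (Or (Not dense_formula) (ForallPath1 1 (meets_formula 1 0))).

(** * Counting the words that avoid marked states *)

Section avoidance.
Variables (Q : finType) (next : Q -> bool -> Q) (lab : Q -> bool).

(** A word is discarded as soon as a prefix, possibly empty, leads from [q] to a marked state; the
    size over [2 ^ m] is the probability of avoiding marked states for [m] steps. *)
Fixpoint avoiding (q : Q) (m : nat) : seq vertex :=
  if lab q then [::] else
  if m is m'.+1 then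
    map (cons false) (avoiding (next q false) m') ++
    map (cons true) (avoiding (next q true) m')
  else [:: [::]].

Lemma mem_avoiding w q : (forall i, i <= size w -> ~~ lab (foldl next q (take i w))) ->
  w \in avoiding q (size w).
Proof.
elim: w q => [|d w IH] q H /=; have /negbTE -> := H 0 isT; first by rewrite inE.
have {}IH : w \in avoiding (next q d) (size w).
  by apply: IH => i iw; exact: (H i.+1 iw).
by rewrite mem_cat; case: d IH {H} => IH; apply/orP; [right|left]; exact: map_f.
Qed.

Variables (n K : nat) (reach : Q -> Prop).
Hypothesis reach_next : forall q d, reach q -> reach (next q d).
Hypothesis avoiding_le : forall q, reach q -> size (avoiding q n) <= K.

Lemma size_avoiding m q : reach q -> size (avoiding q (m + n)) <= 2 ^ m * K.
Proof.
elim: m q => [|m IH] q rq; first by rewrite mul1n avoiding_le.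
rewrite addSn /=; case: ifP => // _; rewrite size_cat !size_map expnS -mulnA mul2n -addnn.
by apply: leq_add; apply: IH; exact: reach_next.
Qed.

(** Among the [2 ^ m] words of length [m], those that extend [u] are discarded; each other one has
    at most [K] continuations. In the induction, the subtree in the direction of [u] saves [K], and
    [size_avoiding] bounds the other one. *)
Lemma size_avoiding_hit m q u : reach q -> size u <= m -> lab (foldl next q u) ->
  size (avoiding q (m + n)) <= (2 ^ m - 1) * K.
Proof.
elim: m q u => [|m IH] q [|d u] rq //=.
- by move=> _ lq; case: n => [|n'] /=; rewrite lq.
- by move=> _ ->.
rewrite ltnS => um lu; case: ifP => // _; rewrite size_cat !size_map.
have -> : (2 ^ m.+1 - 1) * K = (2 ^ m - 1) * K + 2 ^ m * K.
  by rewrite -mulnDl expnS mul2n -addnn addnBAC // expn_gt0.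
have H := IH _ _ (reach_next d rq) um lu.
have H' := size_avoiding m (reach_next (~~ d) rq).
by case: d {lu} H H' => /= H H'; [rewrite addnC|]; apply: leq_add.
Qed.

End avoidance.

Lemma size_avoiding_iter (Q : finType) (next : Q -> bool -> Q) (lab : Q -> bool)
    (reach : Q -> Prop) m :
  (forall q d, reach q -> reach (next q d)) ->
  (forall q, reach q -> exists2 u, size u <= m & lab (foldl next q u)) ->
  forall j q, reach q -> size (avoiding next lab q (m * j)) <= (2 ^ m - 1) ^ j.
Proof.
move=> rn hit; elim=> [|j IH] q rq.
  by rewrite muln0 expn0 /=; case: ifP.
have [u um lu] := hit q rq.
by rewrite mulnS expnS; apply: (size_avoiding_hit rn IH rq um lu).
Qed.

(** * Probability of meeting a set of vertices *)

Section measure.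
Variable R : realType.
Local Open Scope ring_scope.

Lemma determined_measurable n A : determined n A -> measurable (A : set (branchType R)).
Proof.
move=> dA; apply: (@caratheodory_measurable_mu_ext _ R branch (cylinder_mass R)).
by exists n.
Qed.

Lemma mu_w_determined n A : determined n A ->
  @mu_w R A = (#|words n A|%:R / 2 ^+ n)%:E.
Proof.
move=> dA; rewrite -(cylinder_massE R dA).
by apply: (@measurable_mu_extE _ R branch (cylinder_mass R)); exists n.
Qed.

Lemma mu_w_setT : @mu_w R setT = 1%:E.
Proof.
have := @mu_w_cylinder R [::]; rewrite expr0 invr1 => <-; congr mu_w.
by apply/seteqP; split.
Qed.

Lemma hitting_measurable X : measurable (hitting X : set (branchType R)).
Proof.
have -> : hitting X = \bigcup_n [set x | X (mkseq x n)].
  by apply/seteqP; split=> [x [n ?]|x [n _ ?]]; exists n.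
apply: bigcup_measurable => n _; apply: (@determined_measurable n) => x y xy /=.
suff -> : mkseq x n = mkseq y n by [].
by apply/eq_in_map => i; rewrite mem_iota => /andP[_ /xy].
Qed.

(** The paths that meet [X] correspond under [path_of] to [hitting X], a countable union of cylinder
    sets and hence measurable. *)
Lemma path_prob1_hitting X :
  path_prob1 R [set P | is_path P /\ exists v, P v /\ X v] <->
  @mu_w R (hitting X) = 1%E.
Proof.
have E : path_of @^-1` [set P | is_path P /\ exists v, P v /\ X v] = hitting X.
  apply/seteqP; split=> x /=; first by move=> [_ [_ [[n _ <-] Xn]]]; exists n.
  move=> [n Xn]; split; first by have [H _ _] := path_of_bij; exact: H.
  by exists (mkseq x n); split => //; exists n.
by rewrite /path_prob1 E; split=> [[]//|->]; split => //; exact: hitting_measurable.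
Qed.

Lemma sat_witness_formula e1 e2 : sat R witness_formula e1 e2 <->
  dense_in_tree (e2 0) /\ @mu_w R (hitting (e2 0)) <> 1%E.
Proof.
have meetsE Y e : sat R (meets_formula Y 0) e1 e <-> exists v, e Y v /\ e 0 v.
  rewrite /= /update /=; split=> -[v]; last first.
    by move=> [Yv Xv]; exists v => -[].
  by move=> /not_orP[/contrapT ? /contrapT ?]; exists v.
have leavesE e : sat R (leaves_formula 1) e1 e <->
    exists v d, e 1 v /\ ~ e 1 (rcons v d).
  rewrite /= /update /=; split.
    move=> [v [w /not_orP[/contrapT vY /not_orP[wY /contrapT[wE|wE]]]]].
      by exists v, false; rewrite -wE.
    by exists v, true; rewrite -wE.
  move=> [v [d [vY dY]]]; exists v, (rcons v d) => -[//|[//|]].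
  by apply; case: d {dY}; [right|left].
have denseE : sat R dense_formula e1 e2 <-> dense_in_tree (e2 0).
  have satE : sat R dense_formula e1 e2 <-> forall Z, let e := update e2 1 Z in
      ~ (exists v, Z v) \/ (exists v d, Z v /\ ~ Z (rcons v d)) \/ (exists v, Z v /\ e2 0 v).
    split=> H Z; have := H Z; rewrite -/(sat _ _ _ _).
      by move=> [H1|[/leavesE H1|/meetsE H1]]; [left|right; left|right; right].
    by move=> [H1|[H1|H1]]; [left|right; left; apply/leavesE|right; right; apply/meetsE].
  rewrite satE; split=> H Z.
    move=> neZ clZ; have [//|[[v [d [vZ /(_ (clZ _ _ vZ))]]]|]] := H Z => //.
  have [neZ|] := pselect (exists v, Z v); last by left.
  have [clZ|] := pselect (forall v d, Z v -> Z (rcons v d)).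
    by right; right; exact: H.
  move=> /existsNP[v /existsNP[d /not_implyP ?]]; right; left; by exists v, d.
have pathE : sat R (ForallPath1 1 (meets_formula 1 0)) e1 e2 <->
    @mu_w R (hitting (e2 0)) = 1%E.
  rewrite -path_prob1_hitting /=; set S := (X in path_prob1 R X).
  set S' := (X in _ <-> path_prob1 R X); suff -> : S = S' by [].
  apply/seteqP; split=> P [pP HP]; split => //.
    by have /(meetsE 1) := HP.
  by apply/(meetsE 1).
rewrite /witness_formula /= -/(sat R _ _ _); split.
  by move=> /not_orP[/contrapT/denseE ? H]; split => // /pathE.
by move=> [/denseE dX nX] [|/pathE].
Qed.

(** Since there are finitely many states, the distance to a marked state is bounded by one [m], and
    the probability of avoidance decays geometrically. *)
Lemma regular_hitting (Q : finType) (q0 : Q) (next : Q -> bool -> Q) (lab : Q -> bool) :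
  let X := [set w | lab (foldl next q0 w)] in
  dense_in_tree X -> @mu_w R (hitting X) = 1%E.
Proof.
move=> X dX; pose reach q := exists w, q = foldl next q0 w.
have rn q d : reach q -> reach (next q d).
  by move=> [w ->]; exists (rcons w d); rewrite foldl_rcons.
(* Density, applied to the subtree below a vertex [w] that leads to [q], yields a word from [q] to a
   marked state. *)
have /choice[u uP] : forall q, exists u, reach q -> lab (foldl next q u).
  move=> q; have [[w ->]|nr] := pselect (reach q); last by exists [::].
  have [|v d [s ->]|_ [[s ->]]] := dX [set v | exists s, v = w ++ s].
  - by exists w, [::]; rewrite cats0.
  - by exists (rcons s d); rewrite rcons_cat.
  - by rewrite /X /= foldl_cat => ?; exists s.
pose m := \max_q size (u q).
have szA j : (size (avoiding next lab q0 (m * j)) <= (2 ^ m - 1) ^ j)%N.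
  apply: (size_avoiding_iter (reach := reach)) => //; last by exists [::].
  by move=> q rq; exists (u q); [exact: leq_bigmax|exact: uP].
pose B n : set branch := [set x | forall i, (i <= n)%N -> ~ X (mkseq x i)].
have mk_take (x : branch) i n : (i <= n)%N -> take i (mkseq x n) = mkseq x i.
  by move=> i_n; rewrite /mkseq -map_take take_iota (minn_idPl i_n).
have dB n : determined n (B n).
  move=> x y xy Bx i i_n; suff <- : mkseq x i = mkseq y i by exact: Bx.
  apply/eq_in_map => k; rewrite mem_iota add0n => /andP[_ ki].
  by apply: xy; exact: leq_trans i_n.
have cB n : (#|words n (B n)| <= size (avoiding next lab q0 n))%N.
  rewrite cardE -(size_map val); apply: uniq_leq_size.
    by rewrite map_inj_uniq ?enum_uniq //; exact: val_inj.
  move=> _ /mapP[t + ->]; rewrite mem_enum inE => /asboolP[x Bx xt].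
  have sn : size t = n by rewrite size_tuple.
  rewrite -[in avoiding _ _ _ _]sn; apply: mem_avoiding => i; rewrite sn => i_n.
  have -> : val t = mkseq x n by rewrite xt.
  by apply/negP; rewrite mk_take //; exact: Bx.
pose c : R := (2 ^ m - 1)%N%:R / 2 ^+ m.
have c0 : 0 <= c by rewrite divr_ge0 // exprn_ge0.
have c1 : c < 1.
  by rewrite ltr_pdivrMr ?exprn_gt0 // mul1r -natrX ltr_nat ltn_subLR // ?ltnS // expn_gt0.
have mH := hitting_measurable X.
have mC : measurable (~` hitting X : set (branchType R)) by exact: measurableC.
have leC j : (@mu_w R (~` hitting X) <= (c ^+ j)%:E)%E.
  apply: (@le_trans _ _ (@mu_w R (B (m * j)%N))).
    apply: le_measure; rewrite ?inE //; first exact: determined_measurable (dB _).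
    by move=> x nx i _ Xi; apply: nx; exists i.
  rewrite (mu_w_determined (dB _)) lee_fin expr_div_n -exprM.
  rewrite ler_pM2r ?invr_gt0 ?exprn_gt0 // -natrX ler_nat.
  exact: leq_trans (cB _) (szA _).
(* A positive value [r] would exceed [c ^+ N] for large [N]; the bound for [j = 0] excludes an
   infinite value. *)
have C0 : @mu_w R (~` hitting X) = 0%E.
  apply/eqP; rewrite eq_le measure_ge0 andbT leNgt; apply/negP.
  have := leC 0%N; have := measure_ge0 (@mu_w R) (~` hitting X).
  case E : (@mu_w R _) => [r| |] //; rewrite !lte_fin => _ _ r0.
  have /cvgrPdist_lt/(_ r r0)[N _ /(_ N (leqnn N))] : (fun j => c ^+ j) @ \oo --> (0 : R).
    by apply: cvg_expr; rewrite ger0_norm.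
  rewrite sub0r normrN ger0_norm ?exprn_ge0 // ltNge => /negP; apply.
  by have := leC N; rewrite E lee_fin.
have <- : @mu_w R setT = 1%E by exact: mu_w_setT.
rewrite -(setUv (hitting X)) measureU //; last exact: setICr.
by rewrite [X in (_ + X)%E]C0 adde0.
Qed.

Definition sparse_dense : set vertex :=
  [set w | exists v : vertex, w = v ++ nseq (pickle v).+2 false].

Lemma sparse_dense_dense : dense_in_tree sparse_dense.
Proof.
move=> Z [v Zv] clZ; exists (v ++ nseq (pickle v).+2 false); split; last by exists v.
elim: (pickle v).+2 => [|n IH]; first by rewrite cats0.
by rewrite -[n.+1]addn1 nseqD catA cats1; exact: clZ.
Qed.

(** The vertex selected below the one numbered [i] has depth at least [i.+2], so its cylinder has
    measure at most [2 ^- i.+2]; these bounds sum to 1/2. *)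
Lemma sparse_dense_hitting : (@mu_w R (hitting sparse_dense) <= (2^-1)%:E)%E.
Proof.
(* Numbers that encode no vertex get the empty set. *)
pose F i : set (branchType R) := if @unpickle vertex i is Some v
  then @cylinder R (v ++ nseq i.+2 false) else set0.
have mF i : measurable (F i).
  rewrite /F; case: unpickle => [v|]; last exact: measurable0.
  exact: cylinder_measurable.
have HF : hitting sparse_dense `<=` \bigcup_i F i.
  move=> x [n [v nE]]; exists (pickle v) => //; rewrite /F pickleK /cylinder /=.
  by rewrite -nE size_mkseq.
have := measure_sigma_subadditive (@mu_w R) mF (hitting_measurable _) HF.
move=> /le_trans; apply.
apply: le_trans (@epsilon_trick0 R 2^-1 xpredT _); last by rewrite invr_ge0.
apply: lee_nneseries => i _; first by move=> _; exact: measure_ge0.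
rewrite /F; case: unpickle => [v|]; last by rewrite measure0 lee_fin divr_ge0 ?invr_ge0.
rewrite [X in (X <= _)%E]mu_w_cylinder lee_fin size_cat size_nseq -invfM natrX -exprS.
rewrite lef_pV2 ?posrE ?exprn_gt0 // ler_eXn2l ?ltr1n //.
exact: leq_addl.
Qed.

End measure.

Theorem theorem9p4 (R : realType) :
  (forall (n : nat) (D : set ('I_n -> set vertex)),
      S2S_definable R D -> S2S_pi_definable R D) /\
  (exists (n : nat) (D : set ('I_n -> set vertex)),
      S2S_pi_definable R D /\ ~ S2S_definable R D).
Proof.
split=> [n D [phi [_ ofree DE]]|]; first by exists phi.
exists 1, (defined_set R witness_formula); split; first by exists witness_formula.
move=> [phi [S2Sphi _ DE]].
have memD (X : set vertex) : defined_set R witness_formula (fun _ : 'I_1 => X) <->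
    dense_in_tree X /\ @mu_w R (hitting X) <> 1%E.
  have := @sat_witness_formula R (fun=> [::]) (tuple_env (fun _ : 'I_1 => X)).
  suff -> : tuple_env (fun _ : 'I_1 => X) 0 = X by [].
  by rewrite /tuple_env insubT.
have : defined_set R witness_formula (fun _ : 'I_1 => sparse_dense).
  apply/memD; split; first exact: sparse_dense_dense.
  move=> E; have := sparse_dense_hitting R; rewrite E lee_fin leNgt.
  by rewrite invf_lt1 ?ltr1n.
(* A regular model of [phi] would be dense, hence met by almost every path, against the second half
   of [memD]. *)
rewrite DE => /(S2S_regular_model S2Sphi)[Q [q0 [next [lab]]]].
by rewrite -DE => /memD[/(@regular_hitting R) H]; apply.
Qed.
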